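(* Let $\rho\in(0,\pi]$, $h>0$, and let $S\subset\mathbb{R}^d$ with $S\in\tilde{\mathcal{C}}_{\rho,h}$. For $z\ge 0$ let $F(z)=\mu(\{x\in S: d(x,\partial S)\le z\})$, and assume that $F'$ is bounded in a neighborhood of $0$ (i.e. there are $s>0$ and $q>0$ such that $F'(z)\le q$ for every $z\in(0,s]$ at which $F$ is differentiable). Let $X_1,X_2,\ldots$ be i.i.d. drawn from a distribution $P_X$ with support $S$, absolutely continuous with $\mu$-density $f$ such that $0<k_1\le f(x)\le k_2<\infty$ for some constants $k_1,k_2$ and for almost all $x\in S$. Denote $\aleph_n=\{X_1,\ldots,X_n\}$. Then $$\mathbb{E}\Big(d_{P_X}\big(S,\tilde{\mathbb{C}}_{\rho,h}(\aleph_n)\big)\Big)=\mathcal{O}(n^{-1/d}).$$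
   Context: $B(x,h)$ denotes the open Euclidean ball in $\mathbb{R}^d$, $\mu$ the Lebesgue measure on $\mathbb{R}^d$, and $d(x,A)=\inf_{a\in A}\|x-a\|$. For $x\in\mathbb{R}^d$, a unit vector $\xi$, $\rho\in(0,\pi]$ and $h>0$, the finite open cone is $$C_{\rho,\xi,h}(x)=B(x,h)\cap\Big\{z\in\mathbb{R}^d,\ z\ne x:\ \Big\langle \xi,\frac{z-x}{\|z-x\|}\Big\rangle>\cos(\rho/2)\Big\}.$$ $\tilde{\mathcal{C}}_{\rho,h}$ is the class of nonempty compact sets $S\subset\mathbb{R}^d$ such that $S$ equals the intersection of the complements of all cones $C_{\rho,\xi,h}(y)$ ($y\in\mathbb{R}^d$, $\|\xi\|=1$) disjoint from $S$. For a bounded set $A\subset\mathbb{R}^d$, $\tilde{\mathbb{C}}_{\rho,h}(A)$ is the intersection of the complements of all cones $C_{\rho,\xi,h}(y)$ disjoint from $A$. For a Borel measure $\nu$, $d_\nu(A,C)=\nu(A\setminus C)+\nu(C\setminus A)$. The function $F$ is absolutely continuous and differentiable outside a countable set. *)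

(* Defs.v *)
From HB Require Import structures.
From mathcomp Require Import all_boot all_order all_algebra.
From mathcomp Require Import all_classical all_reals all_analysis.
From mathcomp Require Import measurable_realfun.
Set Implicit Arguments.
Unset Strict Implicit.
Unset Printing Implicit Defensive.
Import Order.TTheory GRing.Theory Num.Theory.
Import numFieldNormedType.Exports.
Local Open Scope classical_set_scope.
Local Open Scope ring_scope.

(* R^d with its Borel sigma-algebra; convertible to 'rV[R]_d as a type. *)
Notation borelRV R d := (g_sigma_algebraType (@open 'rV[R]_d)).

Lemma pushforward_sigma_finite d1 d2 (T1 : measurableType d1)
    (T2 : measurableType d2) (R : realType)
    (m : set T1 -> \bar R) (f : T1 -> T2) (g : T2 -> T1) :
  sigma_finite setT m -> cancel f g -> measurable_fun setT g ->
  sigma_finite setT (pushforward m f).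
Proof.
move=> [F FT Ffin] fK mg.
exists (fun n => g @^-1` F n).
  by rewrite -preimage_bigcup -FT preimage_setT.
move=> n; have [mF Foo] := Ffin n; split.
  by rewrite -[X in measurable X]setTI; exact: mg.
rewrite /pushforward -comp_preimage (_ : g \o f = id)//.
by apply/funext => x /=; rewrite fK.
Qed.

Lemma product_sigma_finite d1 d2 (T1 : measurableType d1)
    (T2 : measurableType d2) (R : realType)
    (m1 : {sigma_finite_measure set T1 -> \bar R})
    (m2 : {sigma_finite_measure set T2 -> \bar R}) :
  sigma_finite setT (m1 \x m2)%E.
Proof.
have /sigma_finiteP[F [TF ndF Foo]] := sigma_finiteT m1.
have /sigma_finiteP[G [TG ndG Goo]] := sigma_finiteT m2.
exists (fun n => F n `*` G n).
  apply/seteqP; split => // -[x y] _.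
  have [n _ Fn] : (\bigcup_n F n) x by rewrite -TF.
  have [k _ Gk] : (\bigcup_n G n) y by rewrite -TG.
  exists (maxn n k) => //; split => /=.
    by move: x Fn; exact/subsetPset/ndF/leq_maxl.
  by move: y Gk; exact/subsetPset/ndG/leq_maxr.
move=> k; have [? ?] := Foo k; have [? ?] := Goo k.
split; first exact: measurableX.
by rewrite product_measure1E// lte_mul_pinfty// ge0_fin_numE.
Qed.

Section lebesgue_tuple.
Context {R : realType}.
Local Notation RT := (measurableTypeR R).

Definition tcons n (p : RT * n.-tuple RT) : n.+1.-tuple RT :=
  [tuple of p.1 :: p.2].

Definition tuncons n (t : n.+1.-tuple RT) : RT * n.-tuple RT :=
  (tnth t ord0, [tuple of behead t]).

Lemma tconsK n : cancel (@tcons n) (@tuncons n).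
Proof. by move=> [x t]; rewrite /tuncons /tcons/=; congr pair; apply/val_inj. Qed.

Lemma measurable_tcons n : measurable_fun setT (@tcons n).
Proof. by apply: measurable_cons. Qed.

Lemma measurable_tuncons n : measurable_fun setT (@tuncons n).
Proof.
apply/measurable_fun_pairP; split.
  exact: (@measurable_tnth _ RT).
exact: (@measurable_behead _ RT).
Qed.

Lemma tcons_preimage n (A : 'I_n.+1 -> set RT) :
  @tcons n @^-1` [set t | forall i, A i (tnth t i)] =
  A ord0 `*` [set t | forall i, A (lift ord0 i) (tnth t i)].
Proof.
apply/seteqP; split => [[x t]/= h|[x t]/= [h0 h] i].
  split; first exact: (h ord0).
  by move=> i; have := h (lift ord0 i); rewrite tnthS.
by case: (unliftP ord0 i) => [j ->|-> //]; rewrite tnthS.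
Qed.

Lemma measurable_tuple_box n (A : 'I_n -> set RT) :
  (forall i, measurable (A i)) ->
  measurable [set t : n.-tuple RT | forall i, A i (tnth t i)].
Proof.
move=> mA.
rewrite [X in measurable X](_ : _ =
  \bigcap_(i in [set: 'I_n]) ((fun t : n.-tuple RT => tnth t i) @^-1` A i)).
  apply: fin_bigcap_measurable => // i _.
  by rewrite -[X in measurable X]setTI; exact: (@measurable_tnth _ RT).
by apply/seteqP; split => [t h i _|t h i]; [exact: h|exact: (h i I)].
Qed.

Section step.
Variables (n : nat) (mu : {sigma_finite_measure set (n.-tuple RT) -> \bar R}).

Definition lebesgue_tuple_step : set (n.+1.-tuple RT) -> \bar R :=
  pushforward (lebesgue_measure \x mu)%E (@tcons n).

Let step0 : lebesgue_tuple_step set0 = 0%E.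
Proof. by rewrite /lebesgue_tuple_step /pushforward preimage_set0 measure0. Qed.

Let step_ge0 A : (0 <= lebesgue_tuple_step A)%E.
Proof. by rewrite /lebesgue_tuple_step /pushforward measure_ge0. Qed.

Let step_sigma_additive : semi_sigma_additive lebesgue_tuple_step.
Proof.
apply: measure_semi_sigma_additive; exact: measurable_tcons.
Qed.

HB.instance Definition _ := isMeasure.Build _ _ _ lebesgue_tuple_step
  step0 step_ge0 step_sigma_additive.

Let step_sigma_finite : sigma_finite setT lebesgue_tuple_step.
Proof.
apply: pushforward_sigma_finite (@tconsK n) (@measurable_tuncons n).
exact: product_sigma_finite.
Qed.

HB.instance Definition _ := Measure_isSigmaFinite.Build _ _ _
  lebesgue_tuple_step step_sigma_finite.

End step.

(* Iterated product of the one-dimensional Lebesgue measure; in dimension 0,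
   the unit mass on the empty tuple. *)
Fixpoint lebesgue_tuple n : {sigma_finite_measure set (n.-tuple RT) -> \bar R} :=
  match n with
  | 0 => dirac [tuple]
  | n'.+1 => lebesgue_tuple_step (lebesgue_tuple n')
  end.

Lemma lebesgue_tuple_box n (A : 'I_n -> set RT) :
  (forall i, measurable (A i)) ->
  lebesgue_tuple n [set t | forall i, A i (tnth t i)] =
  (\prod_(i < n) lebesgue_measure (A i))%E.
Proof.
elim: n A => [|n ih] A mA.
  by rewrite big_ord0 /= diracE mem_set// => -[].
rewrite big_ord_recl /= /lebesgue_tuple_step /pushforward tcons_preimage.
rewrite product_measure1E.
- by congr (_ * _)%E; exact: (ih (fun i => A (lift ord0 i))).
- exact: mA.
- exact: (@measurable_tuple_box n (fun i => A (lift ord0 i))).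
Qed.

End lebesgue_tuple.

Section lebesgue_rV.
Context {R : realType} (d : nat).
Local Notation RT := (measurableTypeR R).

Definition tuple_rV (t : d.-tuple RT) : borelRV R d := \row_i tnth t i.

Definition rV_tuple (v : borelRV R d) : d.-tuple RT := [tuple v ord0 i | i < d].

Lemma tuple_rVK : cancel tuple_rV rV_tuple.
Proof. by move=> t; apply: eq_from_tnth => i; rewrite tnth_mktuple mxE. Qed.

Lemma measurable_tuple_rV : measurable_fun setT tuple_rV.
Proof.
apply: (@measurability _ _ (d.-tuple RT) (borelRV R d) setT tuple_rV
  (@open 'rV[R]_d)) => // _ [U oU <-].
rewrite setTI.
pose box (p : {ffun 'I_d -> rat} * nat) : set 'rV[R]_d :=
  [set v | forall i, ball (ratr (p.1 i) : R) p.2.+1%:R^-1 (v ord0 i)].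
pose F p := if `[< box p `<=` U >] then tuple_rV @^-1` box p else set0.
have -> : tuple_rV @^-1` U = \bigcup_p F p.
  apply/seteqP; split => [t /= Ut|t [p _]]; last first.
    by rewrite /F; case: asboolP => // + bt; exact.
  have [e/= e0 eU] := (@nbhs_ballP R 'rV[R]_d _ _).1 (open_nbhs_nbhs (conj oU Ut)).
  have e20 : 0 < e / 2 by rewrite divr_gt0.
  have [k _ ke] := near_infty_natSinv_lt (PosNum e20).
  have k0 : 0 < k.+1%:R^-1 :> R by rewrite invr_gt0.
  have /choice[q hq] : forall i : 'I_d,
      exists q : rat, ball (ratr q : R) k.+1%:R^-1 (tnth t i).
    move=> i.
    have [||y [ty [q _ qy]]] := @dense_rat R (ball (tnth t i : R) k.+1%:R^-1).
    - by exists (tnth t i); exact: ballxx.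
    - exact: ball_open.
    by exists q; rewrite qy; exact: ball_sym.
  exists ([ffun i => q i], k) => //; rewrite /F.
  case: asboolP => [_ i|]; first by rewrite /= ffunE mxE.
  case=> v vb; apply: eU; split=> // i j; rewrite !ord1 mxE.
  apply: (@le_ball _ _ _ (k.+1%:R^-1 + k.+1%:R^-1)).
    by rewrite [leRHS]splitr; apply: lerD; apply/ltW/ke => /=.
  apply: (@ball_triangle _ R^o (ratr (q j))); first exact/ball_sym/hq.
  by have := vb j; rewrite /= ffunE.
apply: countable_bigcupT_measurable => // p; rewrite /F.
case: asboolP => // _.
rewrite [X in measurable X](_ : _ = [set t : d.-tuple RT | forall i,
    ball (ratr (p.1 i) : R) p.2.+1%:R^-1 (tnth t i)]).
  apply: (@measurable_tuple_box R d
    (fun i => ball (ratr (p.1 i) : R) p.2.+1%:R^-1)) => i.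
  exact: measurable_ball.
by apply/seteqP; split => t /= h i; have := h i; rewrite mxE.
Qed.

Lemma measurable_coord (i : 'I_d) :
  @measurable_fun _ _ (borelRV R d) RT setT (fun v => v ord0 i).
Proof.
apply: (@measurability _ _ (borelRV R d) RT setT
  (fun v => v ord0 i) (@RGenOpens.G R)).
  exact: RGenOpens.measurableE.
move=> _ [_ [x [y ->]] <-]; rewrite setTI; apply: sub_sigma_algebra => /=.
by have /continuousP := @coord_continuous R 1 d ord0 i; apply; exact: itv_open.
Qed.

Lemma measurable_rV_tuple : measurable_fun setT rV_tuple.
Proof.
apply/measurable_fun_tnthP => i.
rewrite (_ : _ \o _ = fun v : borelRV R d => v ord0 i : RT).
  exact: measurable_coord.
by apply/funext => v /=; rewrite tnth_mktuple.
Qed.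

Definition lebesgue_rV : set (borelRV R d) -> \bar R :=
  pushforward (@lebesgue_tuple R d) tuple_rV.

Let lebesgue_rV0 : lebesgue_rV set0 = 0%E.
Proof. by rewrite /lebesgue_rV /pushforward preimage_set0 measure0. Qed.

Let lebesgue_rV_ge0 A : (0 <= lebesgue_rV A)%E.
Proof. by rewrite /lebesgue_rV /pushforward measure_ge0. Qed.

Let lebesgue_rV_sigma_additive : semi_sigma_additive lebesgue_rV.
Proof. apply: measure_semi_sigma_additive; exact: measurable_tuple_rV. Qed.

HB.instance Definition _ := isMeasure.Build _ _ _ lebesgue_rV
  lebesgue_rV0 lebesgue_rV_ge0 lebesgue_rV_sigma_additive.

Let lebesgue_rV_sigma_finite : sigma_finite setT lebesgue_rV.
Proof. 
apply: pushforward_sigma_finite tuple_rVK measurable_rV_tuple.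
exact: sigma_finiteT. Qed.

HB.instance Definition _ := Measure_isSigmaFinite.Build _ _ _
  lebesgue_rV lebesgue_rV_sigma_finite.

Lemma lebesgue_rV_box (A : 'I_d -> set RT) :
  (forall i, measurable (A i)) ->
  lebesgue_rV [set v | forall i, A i (v ord0 i)] =
  (\prod_(i < d) lebesgue_measure (A i))%E.
Proof.
move=> mA; rewrite -lebesgue_tuple_box// /lebesgue_rV /pushforward.
congr (lebesgue_tuple d _).
by apply/seteqP; split => t /= h i; have := h i; rewrite mxE.
Qed.

End lebesgue_rV.
Arguments lebesgue_rV {R d}.

(* 'rV[R]_d carries the sup norm in the library; it induces the Euclidean
   topology, so compact, closure, interior and open are used as they are. *)
Section geometry.
Context {R : realType} {d : nat}.
Implicit Types (u v x y z xi : 'rV[R]_d) (A S : set 'rV[R]_d).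

Definition edot u v : R := \sum_i u ord0 i * v ord0 i.

Definition enorm v : R := Num.sqrt (edot v v).

Definition eball x (h : R) : set 'rV[R]_d := [set z | enorm (z - x) < h].

(* Meaningful for nonempty A only: inf set0 = 0. *)
Definition edist_set x A : R := inf [set enorm (x - a) | a in A].

Definition boundary A : set 'rV[R]_d := closure A `\` A°.

Definition cone (rho : R) xi (h : R) x : set 'rV[R]_d :=
  eball x h `&`
  [set z | z <> x /\ cos (rho / 2) < edot xi ((enorm (z - x))^-1 *: (z - x))].

Definition cone_hull (rho h : R) A : set 'rV[R]_d :=
  \bigcap_(p in [set p : 'rV[R]_d * 'rV[R]_d |
                  enorm p.2 = 1 /\ cone rho p.2 h p.1 `&` A = set0])
    ~` cone rho p.2 h p.1.

Definition cone_convex (rho h : R) S : Prop :=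
  [/\ S !=set0, compact S & S = cone_hull rho h S].

(* fine loses nothing for bounded S, whose measure is finite. *)
Definition inner_volume S (z : R) : R :=
  fine (lebesgue_rV [set x | S x /\ edist_set x (boundary S) <= z]).

End geometry.

Section probability_notions.
Context {R : realType}.

Definition msupport d (nu : set (borelRV R d) -> \bar R) : set 'rV[R]_d :=
  [set x | forall U : set 'rV[R]_d, open_nbhs x U -> (0 < nu U)%E].

Definition symdiff_dist d (nu : set (borelRV R d) -> \bar R)
    (A C : set 'rV[R]_d) : \bar R := (nu (A `\` C) + nu (C `\` A))%E.

Definition mutually_independent d d' (T : measurableType d)
    (T' : measurableType d') (P : probability T R) (X : nat -> T -> T') : Prop :=
  forall (J : seq nat) (A : nat -> set T'), uniq J -> (forall i, measurable (A i)) ->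
  P (\bigcap_(i in [set` J]) (X i @^-1` A i)) =
  (\prod_(i <- J) P (X i @^-1` A i))%E.

(* The sequence is indexed from 0: X_1, ..., X_n are X 0, ..., X n.-1. *)
Definition sample T T' (X : nat -> T -> T') (n : nat) (w : T) : set T' :=
  [set X i w | i in `I_n].

End probability_notions.

(* Main.v *)
(* If a point x of S is not in the hull of the sample, then some cone through x misses
   the sample.  Every such cone contains one of finitely many thin cones with vertex x,
   and the latter contains a ball of radius proportional to D x, the distance from x to
   the boundary, inside S; so P (x missed) <= m (1 - c (D x)^d)^n.  Integrating over the
   dyadic collars {D <= 2^j n^(-1/d)} gives the rate, provided that F z = O(z).

   For the latter, contracting the collars towards the boundary shows Kneser's inequality
   F (l b) - F (l a) <= l^d (F b - F a) for l >= 1.  It makes F continuous on the positive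
   reals, forces a derivative wherever a parabola touches the graph from below (hence in
   every interval), and propagates a bound of F' at one point c to the increments of F
   beyond c.  Finally F tends to F 0, the measure of the boundary, which vanishes: the
   boundary is covered by finitely many compact sets, each disjoint from its small
   translates in some direction. *)

From HB Require Import structures.
Require Import Defs.
From mathcomp Require Import all_boot all_order all_algebra.
From mathcomp Require Import all_classical all_reals all_analysis.
From mathcomp Require Import measurable_realfun ring lra.
Set Implicit Arguments.
Unset Strict Implicit.
Unset Printing Implicit Defensive.
Import Order.TTheory GRing.Theory Num.Theory.
Import numFieldNormedType.Exports.
Local Open Scope classical_set_scope.
Local Open Scope ring_scope.

(** * Lebesgue measure under affine maps *)

(** The cones avoiding the sample have arbitrary vertices and form an infinite family. Finitely many
    thin cones with vertex x allow a union bound, and they make the set of pairs (x, outcome) with a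
    missed probe jointly measurable, as Fubini requires. The ball shrinks with D x because the
    density is bounded below on S only. The j-th collar has mass O(2^j n^(-1/d)) and a probability
    of missing O(4^(-j)), so the dyadic sum is geometric.

    The hypothesis on F' concerns only points of differentiability away from 0. By itself it does
    not exclude a jump of F at 0, whence the null boundary. Kneser's inequality lets one such point
    control every increment to its right, so a single point of differentiability in each interval is
    enough and F' is never integrated. *)

Section affine_image.
Context {R : realType}.
Local Notation RT := (measurableTypeR R).

Lemma measurable_affine (c b : R) :
  measurable_fun setT (fun x : RT => c * x + b : RT).
Proof. by apply: measurable_funD => //; exact: measurable_funM. Qed.

(** By uniqueness of Lebesgue measure, it is enough that [c] times the pushforward gives half-open
    intervals their length. *)
Lemma lebesgue_measure_affine (c b : R) (A : set RT) : 0 < c -> measurable A ->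
  lebesgue_measure A =
    (c%:E * lebesgue_measure ((fun x : RT => (c * x + b)%R : RT) @^-1` A))%E.
Proof.
move=> c0 mA.
pose m := measure_function_pushforward__canonical__measure_function_Measure
  (@lebesgue_measure R) (measurable_affine c b).
apply: (@lebesgue_measure_unique R (mscale (NngNum (ltW c0)) m)) => //.
move=> _ [[x y] _ <-];
transitivity (c%:E * @lebesgue_measure R [set` `](x - b) / c, (y - b) / c]%R])%E;
    last first.
  congr (_ * lebesgue_measure _)%E; apply/seteqP.
  split => z /=; rewrite !in_itv /= ltr_pdivrMr// ler_pdivlMr//.
    by rewrite ltrBlDr lerBrDr mulrC.
  by rewrite ltrBlDr lerBrDr mulrC.
rewrite !lebesgue_measure_itv /= !lte_fin ltr_pM2r ?invr_gt0// ltrD2r.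
case: ifPn => xy; last by rewrite mule0.
by rewrite -!EFinB -EFinM; congr EFin; field; rewrite gt_eqF.
Qed.

Definition tuple_affine n (c : R) (b : 'I_n -> R) (t : n.-tuple RT) :
  n.-tuple RT := [tuple (c * tnth t i + b i : RT) | i < n].

Lemma measurable_tuple_affine n (c : R) (b : 'I_n -> R) :
  measurable_fun setT (tuple_affine c b).
Proof.
apply/measurable_fun_tnthP => i.
rewrite (_ : _ \o _ = (fun x : RT => c * x + b i : RT) \o
    (fun t : n.-tuple RT => tnth t i)); last first.
  by apply/funext => t /=; rewrite tnth_mktuple.
apply: measurableT_comp; first exact: measurable_affine.
exact: measurable_tnth.
Qed.

Lemma lebesgue_tuple_affine n (c : R) (b : 'I_n -> R) (A : set (n.-tuple RT)) :
  0 < c -> measurable A ->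
  lebesgue_tuple n A = ((c ^+ n)%:E * lebesgue_tuple n (tuple_affine c b @^-1` A))%E.
Proof.
move=> c0; elim: n b A => [b A _|n ih b A mA].
  rewrite expr0 mul1e; congr (_ _); apply/funext => t /=.
  by rewrite [tuple_affine _ _ _]tuple0 [t]tuple0.
rewrite /= /lebesgue_tuple_step /pushforward.
set B := tcons (n:=n) @^-1` A.
have mB : measurable B.
  by rewrite -[X in measurable X]setTI; exact: measurable_tcons.
pose g (p : RT * n.-tuple RT) : RT * n.-tuple RT :=
  (c * p.1 + b ord0, tuple_affine c (fun i => b (lift ord0 i)) p.2).
have mg : measurable_fun setT g.
  apply/measurable_fun_pairP; split.
    apply: (measurableT_comp (measurable_affine c (b ord0))).
    exact: measurable_fst.
  apply: (measurableT_comp (measurable_tuple_affine _ _)).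
  exact: measurable_snd.
rewrite (_ : tcons (n:=n) @^-1` _ = g @^-1` B); last first.
  apply/funext => -[x t] /=; congr (A _); apply: eq_from_tnth => i.
  rewrite tnth_mktuple; case: (unliftP ord0 i) => [j ->|->].
    by rewrite !tnthS tnth_mktuple.
  by rewrite !tnth0.
pose m := measure_function_pushforward__canonical__measure_function_Measure
  (@lebesgue_measure R \x lebesgue_tuple n)%E mg.
have cn0 : 0 <= c ^+ n.+1 by rewrite exprn_ge0 ?ltW.
(* Uniqueness of the product measure reduces the claim to rectangles, where the factor [c] of the
   first coordinate meets the induction hypothesis. *)
apply: (@product_measure_unique _ _ _ _ _ _ _ (mscale (NngNum cn0) m)) => //.
move=> C D mC mD.
transitivity ((c ^+ n.+1)%:E * (@lebesgue_measure R \x lebesgue_tuple n)%E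
    (((fun x : RT => (c * x + b ord0)%R : RT) @^-1` C) `*`
     (tuple_affine c (fun i => b (lift ord0 i)) @^-1` D)))%E; first by [].
rewrite product_measure1E//.
- have -> := ih (fun i => b (lift ord0 i)) D mD.
  have := lebesgue_measure_affine (b ord0) c0 mC => /= ->.
  by rewrite exprS EFinM muleACA.
- by rewrite -[X in measurable X]setTI; exact: measurable_affine.
- by rewrite -[X in measurable X]setTI; exact: measurable_tuple_affine.
Qed.

End affine_image.

Lemma lebesgue_rV_affine {R : realType} {d : nat} (c : R) (b : 'rV[R]_d)
    (A : set (borelRV R d)) : 0 < c -> measurable A ->
  lebesgue_rV A = ((c ^+ d)%:E *
    lebesgue_rV ((fun x : borelRV R d => (c *: x + b)%R : 'rV[R]_d) @^-1` A))%E.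
Proof.
move=> c0 mA; rewrite /lebesgue_rV /pushforward.
rewrite (lebesgue_tuple_affine (b ord0) c0); last first.
  by rewrite -[X in measurable X]setTI; exact: measurable_tuple_rV.
congr (_ * _)%E; congr (lebesgue_tuple d _); apply/funext => t /=.
by congr (A _); apply/rowP => i; rewrite !mxE tnth_mktuple.
Qed.

Lemma lebesgue_rV_translate {R : realType} {d : nat} (b : 'rV[R]_d)
    (A : set (borelRV R d)) : measurable A ->
  lebesgue_rV ((fun x : borelRV R d => (x + b : 'rV[R]_d)) @^-1` A) = lebesgue_rV A.
Proof.
move=> mA; rewrite (lebesgue_rV_affine b ltr01 mA) expr1n mul1e.
by congr (lebesgue_rV _); apply/funext => x /=; rewrite scale1r.
Qed.

(** * Euclidean norm *)

Section euclidean_norm.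
Context {R : realType} {d : nat}.
Implicit Types (u v w x y : 'rV[R]_d) (c : R).

Lemma edotC u v : edot u v = edot v u.
Proof. by apply: eq_bigr => i _; rewrite mulrC. Qed.

Lemma edotDl u v w : edot (u + v) w = edot u w + edot v w.
Proof. by rewrite -big_split; apply: eq_bigr => i _; rewrite mxE mulrDl. Qed.

Lemma edotZl c u v : edot (c *: u) v = c * edot u v.
Proof. by rewrite /edot mulr_sumr; apply: eq_bigr => i _; rewrite mxE mulrA. Qed.

Lemma edotDr u v w : edot w (u + v) = edot w u + edot w v.
Proof. by rewrite edotC edotDl !(edotC w). Qed.

Lemma edotZr c u v : edot v (c *: u) = c * edot v u.
Proof. by rewrite edotC edotZl edotC. Qed.

Lemma edot_ge0 v : 0 <= edot v v.
Proof. by apply: sumr_ge0 => i _; rewrite -expr2 sqr_ge0. Qed.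

Lemma enorm_ge0 v : 0 <= enorm v.
Proof. exact: sqrtr_ge0. Qed.

Lemma sqr_enorm v : enorm v ^+ 2 = edot v v.
Proof. by rewrite sqr_sqrtr// edot_ge0. Qed.

Lemma enormZ c v : enorm (c *: v) = `|c| * enorm v.
Proof. by rewrite /enorm edotZl edotZr mulrA sqrtrM -?expr2 ?sqr_ge0// sqrtr_sqr. Qed.

Lemma enorm0 : enorm (0 : 'rV[R]_d) = 0.
Proof. by rewrite -[0](scale0r 0) enormZ normr0 mul0r. Qed.

Lemma enormN v : enorm (- v) = enorm v.
Proof. by rewrite -scaleN1r enormZ normrN1 mul1r. Qed.

Lemma enorm_distC u v : enorm (u - v) = enorm (v - u).
Proof. by rewrite -enormN opprB. Qed.

Lemma coord_le_enorm v i : `|v ord0 i| <= enorm v.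
Proof.
rewrite -(@ler_pXn2r _ 2)// ?nnegrE ?enorm_ge0// sqr_enorm real_normK ?num_real//.
rewrite /edot (bigD1 i)//= -expr2 lerDl.
by apply: sumr_ge0 => j _; rewrite -expr2 sqr_ge0.
Qed.

Lemma norm_le_enorm v : `|v| <= enorm v.
Proof.
rewrite /Num.norm /= mx_normrE; apply: bigmax_le; first exact: enorm_ge0.
by move=> -[i j] _ /=; rewrite ord1; exact: coord_le_enorm.
Qed.

Lemma coord_le_norm v i : `|v ord0 i| <= `|v|.
Proof. by rewrite [leRHS]/Num.norm /= mx_normrE; apply: (le_bigmax _ _ (ord0, i)). Qed.

(** The factor [d] is cruder than its square root, but only the rate in n matters. *)
Lemma enorm_le_norm v : enorm v <= d%:R * `|v|.
Proof.
rewrite -(@ler_pXn2r _ 2)// ?nnegrE ?enorm_ge0 ?mulr_ge0// sqr_enorm.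
apply: (@le_trans _ _ (\sum_(i < d) `|v| ^+ 2)).
  apply: ler_sum => i _; rewrite -expr2 -[leLHS]real_normK ?num_real//.
  by rewrite ler_pXn2r ?nnegrE// coord_le_norm.
rewrite sumr_const card_ord exprMn -[leLHS]mulr_natl ler_wpM2r ?sqr_ge0//.
by rewrite -natrX ler_nat; case: (d) => // n; rewrite leq_pmulr.
Qed.

Lemma cauchy_schwarz u v : edot u v <= enorm u * enorm v.
Proof.
have [v0|v0] := eqVneq (enorm v) 0.
  have -> : v = 0.
    apply/rowP => i; rewrite mxE; apply/eqP; rewrite -normr_le0.
    by rewrite (le_trans (coord_le_enorm v i))// v0.
  by rewrite -[0](scale0r 0) edotZr enormZ normr0 !mul0r mulr0.
have vp : 0 < enorm v by rewrite lt_def v0 enorm_ge0.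
have [w0|w0] := leP (edot u v) 0.
  by rewrite (le_trans w0)// mulr_ge0 ?enorm_ge0.
rewrite -(@ler_pXn2r _ 2)// ?nnegrE ?mulr_ge0 ?enorm_ge0 ?(ltW w0)//.
rewrite exprMn -(@ler_pM2r _ (enorm v ^+ 2)) ?exprn_gt0//.
(* The residual of the projection of [u] on [v], scaled by [enorm v ^+ 2] to avoid a division. *)
have := edot_ge0 (enorm v ^+ 2 *: u - edot u v *: v).
rewrite -scaleNr !(edotDl, edotDr, edotZl, edotZr) (edotC v u) -!sqr_enorm.
set a := enorm u; set b := enorm v; set k := edot u v => h.
have {}h : 0 <= b ^+ 2 * (a ^+ 2 * b ^+ 2 - k ^+ 2) by move: h; congr (_ <= _); ring.
by move: h; rewrite pmulr_rge0 ?exprn_gt0// subr_ge0 ler_pM2r ?exprn_gt0.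
Qed.

Lemma enormD u v : enorm (u + v) <= enorm u + enorm v.
Proof.
rewrite -(@ler_pXn2r _ 2)// ?nnegrE ?addr_ge0 ?enorm_ge0// sqr_enorm.
rewrite !(edotDl, edotDr) (edotC v u) sqrrD -!sqr_enorm.
by have := cauchy_schwarz u v; lra.
Qed.

Lemma enorm_triangle x y w : enorm (x - w) <= enorm (x - y) + enorm (y - w).
Proof. by rewrite (le_trans _ (enormD _ _))// addrA subrK. Qed.

Lemma edot_unit_le xi v : enorm xi = 1 -> `|edot xi v| <= enorm v.
Proof.
move=> xi1; rewrite ler_norml -[enorm v]mul1r -xi1 cauchy_schwarz andbT lerNl.
by rewrite -enormN -[leLHS]mulN1r -edotZl scaleN1r cauchy_schwarz.
Qed.

End euclidean_norm.

(** * Neighbourhoods, Lipschitz functions and Borel sets of R^d *)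

Section borel_rV.
Context {R : realType} {d : nat}.
Local Notation RT := (measurableTypeR R).

Lemma near_norm (x : 'rV[R]_d) (A : set 'rV[R]_d) :
  nbhs x A <-> exists2 e : R, 0 < e & forall y, `|y - x| < e -> A y.
Proof.
split=> [/nbhs_ballP[e /= e0 eA]|[e e0 eA]].
  by exists e => // y yx; apply: eA; rewrite -ball_normE /= distrC.
by apply/nbhs_ballP; exists e => //= y; rewrite -ball_normE /= distrC; exact: eA.
Qed.

Lemma lipschitz_continuous_rV (f : 'rV[R]_d -> R) (K : R) :
  (forall x y, f x <= f y + K * `|x - y|) -> continuous f.
Proof.
move=> fK x.
apply: (proj2 (@cvgrPdist_lt R R _ (nbhs x) (nbhs_filter x) f (f x))) => e e0.
apply/near_norm.
(* The sign of [K] is free, so its absolute value plus 1 is the positive constant to divide by. *)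
have K0 : 0 < `|K| + 1 by rewrite ltr_pwDr.
exists (e / (`|K| + 1)); first by rewrite divr_gt0.
move=> y yx; have yxe : (`|K| + 1) * `|y - x| < e by rewrite mulrC -ltr_pdivlMr.
have h : K * `|y - x| <= (`|K| + 1) * `|y - x|.
  by rewrite ler_wpM2r// (le_trans (ler_norm _))// lerDl.
rewrite ltr_norml; apply/andP; split.
  by have := fK y x; lra.
by have := fK x y; rewrite (distrC x); lra.
Qed.

Lemma open_borel_measurable (U : set (borelRV R d)) :
  @open 'rV[R]_d U -> measurable U.
Proof. exact: sub_sigma_algebra. Qed.

Lemma closed_borel_measurable (C : set (borelRV R d)) :
  @closed 'rV[R]_d C -> measurable C.
Proof.
move=> cC; rewrite -[C]setCK; apply: measurableC; apply: open_borel_measurable.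
by rewrite openC.
Qed.

Lemma continuous_borel_measurable (f : 'rV[R]_d -> R) :
  continuous f -> @measurable_fun _ _ (borelRV R d) RT setT f.
Proof.
move=> cf; apply: (@measurability _ _ (borelRV R d) RT setT f (@RGenOpens.G R)).
  exact: RGenOpens.measurableE.
move=> _ [_ [x [y ->]] <-]; rewrite setTI; apply: sub_sigma_algebra => /=.
by move/continuousP : cf; apply; exact: itv_open.
Qed.

End borel_rV.

(** * Distance to the boundary *)

Section distance.
Context {R : realType} {d : nat}.
Implicit Types (x y z a : 'rV[R]_d) (A S : set 'rV[R]_d).

Lemma edist_set_ge0 x A : 0 <= edist_set x A.
Proof.
have [->|/set0P[a Aa]] := eqVneq A set0.
  by rewrite /edist_set image_set0 inf0.
apply: lb_le_inf; first by exists (enorm (x - a)), a.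
by move=> _ [b _ <-]; exact: enorm_ge0.
Qed.

Lemma edist_set_le x a A : A a -> edist_set x A <= enorm (x - a).
Proof.
move=> Aa; apply: ge_inf; last by exists a.
by exists 0 => _ [b _ <-]; exact: enorm_ge0.
Qed.

Lemma edist_set_lt x A (r : R) : A !=set0 -> edist_set x A < r ->
  exists2 a, A a & enorm (x - a) < r.
Proof.
move=> [a0 Aa0] xr; apply: contrapT => h; move: xr; rewrite ltNge => /negP; apply.
apply: lb_le_inf; first by exists (enorm (x - a0)), a0.
move=> _ [b Ab <-]; rewrite leNgt; apply/negP => bx; apply: h.
by exists b.
Qed.

Lemma edist_set_lip x y A : A !=set0 ->
  edist_set x A <= edist_set y A + enorm (x - y).
Proof.
move=> A0; rewrite leNgt; apply/negP; rewrite -ltrBrDr => /(edist_set_lt A0)[a Aa].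
rewrite ltrBrDr ltNge => /negP; apply.
by rewrite (le_trans (edist_set_le x Aa))// [leRHS]addrC enorm_triangle.
Qed.

Lemma edist_set_continuous A : A !=set0 -> continuous (edist_set ^~ A).
Proof.
move=> A0; apply: (@lipschitz_continuous_rV _ _ _ d%:R) => x y.
by rewrite (le_trans (edist_set_lip x y A0))// lerD2l enorm_le_norm.
Qed.

Lemma edist_set_le0 x A : A !=set0 -> closed A -> edist_set x A <= 0 -> A x.
Proof.
move=> A0 cA x0; apply: cA => U /near_norm[e e0 eU].
have [a Aa xa] := edist_set_lt A0 (le_lt_trans x0 e0).
by exists a; split => //; apply: eU; rewrite distrC (le_lt_trans (norm_le_enorm _)).
Qed.

Lemma boundary_closed S : closed (boundary S).
Proof.
apply: closedI; first exact: closed_closure.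
by rewrite closedC; exact: open_interior.
Qed.

Lemma boundary_sub S : closed S -> boundary S `<=` S.
Proof. by move=> cS x [+ _]; move/closure_id : cS => <-. Qed.

(** The parameter is the supremum of those whose point is in [S]: closedness keeps its point in [S],
    and an interior point would allow a larger parameter. *)
Lemma boundary_segment S x y : closed S -> S x -> ~ S y ->
  exists2 t : R, 0 <= t <= 1 & boundary S (x + t *: (y - x)).
Proof.
move=> cS Sx nSy.
pose p (t : R) := x + t *: (y - x).
have pE s t : `|p s - p t| = `|s - t| * `|y - x|.
  by rewrite /p opprD addrACA subrr add0r -scalerBl normrZ.
pose E := [set t : R | 0 <= t <= 1 /\ S (p t)].
have E0 : E 0 by rewrite /E /p /= lexx ler01 scale0r addr0.
have ubE : ubound E 1 by move=> t [/andP[]].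
have supE : has_sup E by split; [exists 0|exists 1].
pose s := sup E.
have s0 : 0 <= s by exact: (ub_le_sup supE.2 E0).
have s1 : s <= 1 by apply: ge_sup => //; exists 0.
have K0 : 0 < `|y - x| + 1 by rewrite ltr_pwDr.
have Ss : S (p s).
  apply: cS => U /near_norm[e e0 eU].
  have e'0 : 0 < e / (`|y - x| + 1) by rewrite divr_gt0.
  have [t Et st] := sup_adherent e'0 supE.
  exists (p t); split; first by case: Et.
  apply: eU; rewrite pE.
  have ts : t <= s by exact: (ub_le_sup supE.2 Et).
  rewrite ler0_norm ?subr_le0// opprB.
  have : (s - t) * (`|y - x| + 1) < e by rewrite -ltr_pdivlMr// ltrBlDr -ltrBlDl.
  by apply: le_lt_trans; rewrite ler_wpM2l ?subr_ge0// lerDl.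
exists s; first by rewrite s0.
split; first exact: subset_closure.
move=> /near_norm[e e0 eS].
have s1' : s < 1.
  rewrite lt_neqAle s1 andbT; apply/eqP => se; apply: nSy.
  by move: Ss; rewrite /p se scale1r addrC subrK.
pose r := Num.min (1 - s) (e / (`|y - x| + 1) / 2).
have r0 : 0 < r by rewrite lt_min subr_gt0 s1' !divr_gt0.
have : s + r <= s.
  apply: (ub_le_sup supE.2); split.
    by rewrite addr_ge0 ?(ltW r0)//= -lerBrDl ge_min lexx.
  apply: eS; rewrite -[X in `|X|]/(p (s + r) - p s) pE addrAC subrr add0r.
  rewrite gtr0_norm//.
  apply: (@le_lt_trans _ _ (e / (`|y - x| + 1) / 2 * (`|y - x| + 1))).
    by apply: ler_pM => //; rewrite ?(ltW r0) ?ge_min ?lexx ?orbT ?lerDl.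
  rewrite mulrAC mulfVK ?gt_eqF// ltr_pdivrMr//; lra.
by rewrite gerDl leNgt r0.
Qed.

(** Used by contraposition: a point closer to [x] than the boundary is must belong to [S]. *)
Lemma edist_boundary_le S x y : closed S -> S x -> ~ S y ->
  edist_set x (boundary S) <= enorm (y - x).
Proof.
move=> cS Sx nSy; have [t /andP[t0 t1] bt] := boundary_segment cS Sx nSy.
rewrite (le_trans (edist_set_le x bt))// opprD addrA subrr add0r enormN enormZ.
by rewrite ger0_norm// ler_piMl ?enorm_ge0.
Qed.

Lemma compact_norm_bounded S : compact S -> exists2 M : R, 0 < M & forall x, S x -> `|x| <= M.
Proof.
move=> /compact_bounded[M [_ hM]]; exists (`|M| + 1); first by rewrite ltr_pwDr.
by move=> x Sx; apply: hM => //; rewrite ltr_pwDr// ler_norm.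
Qed.

(** Needed because the distance to an empty boundary would be the default value 0. The point outside
    [S] is detected by one coordinate, whence the positive dimension. *)
Lemma boundary_neq0 S : (0 < d)%N -> S !=set0 -> compact S -> boundary S !=set0.
Proof.
move=> d0 [x Sx] cS; have [M M0 hM] := compact_norm_bounded cS.
pose y : 'rV[R]_d := const_mx (M + 1).
have nSy : ~ S y.
  move=> /hM; rewrite leNgt => /negP; apply.
  apply: (@lt_le_trans _ _ `|y ord0 (Ordinal d0)|); last exact: coord_le_norm.
  by rewrite mxE gtr0_norm ?addr_gt0// ltrDl.
have [t _ bt] := boundary_segment (compact_closed (@norm_hausdorff _ _) cS) Sx nSy.
by exists (x + t *: (y - x)).
Qed.

End distance.

Lemma edist_boundary_bounded {R : realType} {d : nat} (S : set 'rV[R]_d) :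
  compact S -> boundary S !=set0 ->
  exists2 B : R, 0 < B & forall x, S x -> edist_set x (boundary S) <= B.
Proof.
move=> cptS [b bb]; have [M M0 SM] := compact_norm_bounded cptS.
exists (d%:R * (M + `|b|) + 1).
  by rewrite ltr_wpDl// mulr_ge0// addr_ge0// ltW.
move=> x Sx; rewrite (le_trans (edist_set_le x bb))// (le_trans (enorm_le_norm _))//.
rewrite (@le_trans _ _ (d%:R * (M + `|b|)))// ?lerDl//.
by rewrite ler_wpM2l// (le_trans (ler_normB _ _))// lerD2r; exact: SM.
Qed.

(** * Cones *)

Section nets.
Context {R : realType} {d : nat}.

Lemma compact_net (K : set 'rV[R]_d) (e : R) : compact K -> 0 < e ->
  exists s : seq 'rV[R]_d, (forall v, v \in s -> K v) /\
    forall x, K x -> exists2 v, v \in s & `|x - v| < e.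
Proof.
rewrite compact_cover => cK e0.
have [||D DK Kcov] := cK _ K (fun v => ball v e).
- by move=> v _; exact: ball_open.
- by move=> x Kx; exists x => //; exact: ballxx.
exists (finmap.enum_fset D); split; first by move=> v /DK; rewrite inE.
move=> x /Kcov[v vD]; rewrite -ball_normE /= => vx.
by exists v => //; rewrite distrC.
Qed.

Lemma compact_norm_le (M : R) : compact [set v : 'rV[R]_d | `|v| <= M].
Proof.
apply: bounded_closed_compact.
  by exists M; split; [rewrite num_real|move=> x Mx v /= /le_trans; apply; exact: ltW].
rewrite (_ : mkset _ = Num.norm @^-1` [set x : R | x <= M])//.
by apply: preimage_closed => [x _|]; [exact: norm_continuous|exact: closed_le].
Qed.

End nets.

Section cones.
Context {R : realType} {d : nat}.
Variables (rho h : R) (rho_bounds : 0 < rho <= pi) (h_gt0 : 0 < h).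
Implicit Types (x y z xi v : 'rV[R]_d).

Let gam : R := cos (rho / 2).

Let gam_ge0 : 0 <= gam.
Proof.
case/andP: rho_bounds => r0 rpi; apply: cos_ge0_pihalf.
rewrite ler_pM2r ?invr_gt0// rpi andbT (le_trans _ (ltW (divr_gt0 r0 _)))//.
by rewrite oppr_le0 divr_ge0 ?pi_ge0.
Qed.

Let gam_lt1 : gam < 1.
Proof.
case/andP: rho_bounds => r0 rpi; rewrite -cos0 /gam; have := @pi_gt0 R => pi0.
rewrite ltr_cos ?in_itv /= ?divr_gt0// ?lexx ?pi_ge0 ?divr_ge0 ?(ltW r0)//=.
by rewrite ler_pdivrMr// (le_trans rpi)// ler_peMr ?ltW// ltr1n.
Qed.

(** Clearing the denominator absorbs the condition [z <> y], since the strict inequality fails at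
    the vertex. *)
Lemma in_cone xi y z : cone rho xi h y z <->
  enorm (z - y) < h /\ cos (rho / 2) * enorm (z - y) < edot xi (z - y).
Proof.
split=> [[zh [zy]]|[zh zc]].
  have z0 : 0 < enorm (z - y).
    rewrite lt_def enorm_ge0 andbT; apply/negP => /eqP z0; apply: zy.
    apply/eqP; rewrite -subr_eq0 -normr_le0 -z0; exact: norm_le_enorm.
  by rewrite edotZr [_^-1 * _]mulrC ltr_pdivlMr.
have zy : z <> y.
  move=> zy; move: zc; rewrite zy subrr enorm0 mulr0 -(scale0r (0 : 'rV[R]_d)).
  by rewrite edotZr mul0r ltxx.
do 2?split => //.
have z0 : 0 < enorm (z - y).
  rewrite lt_def enorm_ge0 andbT; apply/negP => /eqP z0; apply: zy.
  apply/eqP; rewrite -subr_eq0 -normr_le0 -z0; exact: norm_le_enorm.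
by rewrite edotZr [_^-1 * _]mulrC ltr_pdivlMr.
Qed.

(** As [rho <= pi], [gam] is nonnegative, so [gam * enorm (z - y) - edot xi (z - y)] is convex in
    [z]. *)
Lemma cone_convex_comb xi y z1 z2 (t : R) : 0 <= t <= 1 ->
  cone rho xi h y z1 -> cone rho xi h y z2 ->
  cone rho xi h y ((1 - t) *: z1 + t *: z2).
Proof.
move=> /andP[t0 t1] /in_cone[h1 c1] /in_cone[h2 c2]; apply/in_cone.
have -> : (1 - t) *: z1 + t *: z2 - y = (1 - t) *: (z1 - y) + t *: (z2 - y).
  by apply/rowP => i; rewrite !mxE; ring.
rewrite -/gam in c1 c2 *.
set u1 := z1 - y in h1 c1 *; set u2 := z2 - y in h2 c2 *.
have hn : enorm ((1 - t) *: u1 + t *: u2) <= (1 - t) * enorm u1 + t * enorm u2.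
  by rewrite (le_trans (enormD _ _))// !enormZ !ger0_norm// subr_ge0.
have := ler_wpM2l gam_ge0 hn; rewrite edotDr !edotZr.
have [->|t_neq0] := eqVneq t 0.
  by rewrite scale0r subr0 scale1r addr0 !mul0r !mul1r !addr0; split.
have tp : 0 < t by rewrite lt_def t_neq0.
have := mulr_gt0 tp (_ : 0 < h - enorm u2); rewrite subr_gt0 => /(_ h2).
have := mulr_gt0 tp (_ : 0 < edot xi u2 - gam * enorm u2).
rewrite subr_gt0 => /(_ c2).
have := mulr_ge0 (_ : 0 <= 1 - t) (_ : 0 <= h - enorm u1).
rewrite !subr_ge0 => /(_ t1 (ltW h1)).
have := mulr_ge0 (_ : 0 <= 1 - t) (_ : 0 <= edot xi u1 - gam * enorm u1).
rewrite !subr_ge0 => /(_ t1 (ltW c1)).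
move=> ? ? ? ? ?; split; nra.
Qed.

(** The center is the midpoint of the axis. As [gam < 1], the radius gives
    [(1 + gam) * enorm w < h / 2 * (1 - gam)], which is enough for the angular condition. *)
Lemma cone_inner_ball xi y w : enorm xi = 1 -> enorm w < h / 4 * (1 - gam) ->
  cone rho xi h y (y + (h / 2) *: xi + w).
Proof.
move=> xi1 wh; apply/in_cone; rewrite -/gam.
rewrite (_ : _ - y = (h / 2) *: xi + w); last first.
  by apply/rowP => i; rewrite !mxE; ring.
have := enormD ((h / 2) *: xi) w.
have h20 : 0 <= h / 2 by rewrite divr_ge0 ?(ltW h_gt0).
rewrite enormZ xi1 mulr1 (ger0_norm h20) => hn.
have := ler_wpM2l gam_ge0 hn.
rewrite edotDr edotZr -sqr_enorm xi1 expr1n mulr1.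
have := edot_unit_le w xi1; rewrite ler_norml => /andP[+ _].
move: wh gam_ge0 gam_lt1 h_gt0 (enorm_ge0 w) => *; split; nra.
Qed.

Lemma cone_open xi y : open (cone rho xi h y).
Proof.
rewrite (_ : cone _ _ _ _ = (fun z => enorm (z - y)) @^-1` [set r | r < h] `&`
  (fun z => edot xi (z - y) - gam * enorm (z - y)) @^-1` [set r | 0 < r]).
  have cn : continuous (fun z => enorm (z - y)).
    apply: (@lipschitz_continuous_rV _ _ _ d%:R) => x z.
    by rewrite -lerBlDl (le_trans _ (enorm_le_norm _))// lerBlDl [leRHS]addrC enorm_triangle.
  apply: openI; first by apply: open_comp => [z _|]; [exact: cn|exact: open_lt].
  apply: open_comp => [z _|]; last exact: open_gt.
  apply: (@lipschitz_continuous_rV _ _ _ ((enorm xi + gam) * d%:R)) => {}z x.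
  have e1 : edot xi (z - y) = edot xi (z - x) + edot xi (x - y).
    by rewrite -edotDr addrA subrK.
  have := cauchy_schwarz xi (z - x).
  have := ler_wpM2l gam_ge0 (enorm_triangle x z y).
  rewrite (enorm_distC x z) => h1 h2.
  have := ler_wpM2l (addr_ge0 (enorm_ge0 xi) gam_ge0) (enorm_le_norm (z - x)).
  by lra.
by apply/seteqP; split => z /=; rewrite in_cone subr_gt0.
Qed.

Lemma cone_hull_closed (A : set 'rV[R]_d) : closed (cone_hull rho h A).
Proof. by apply: closed_bigI => p _; rewrite closedC; exact: cone_open. Qed.

(* Finitely many thin cones with vertex at [x], directed by the [v]'s, suffice
   to find one inside any of the cones through [x]. *)
Lemma cone_directions : exists (vs : seq 'rV[R]_d) (k : R), [/\ 0 < k,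
  (forall v, v \in vs -> `|v| <= 2 * h) &
  forall xi y x, enorm xi = 1 -> cone rho xi h y x ->
    exists2 v, v \in vs & forall (t : R) (e : 'rV[R]_d), 0 < t <= 1 ->
      `|e| < t * k -> cone rho xi h y (x + t *: v + e)].
Proof.
(* The inner ball of radius [h / 4 * (1 - gam)] absorbs two errors, that of the net and [e], each
   below [k] in sup norm after scaling; [d.+1] converts to the Euclidean norm and is never zero. *)
pose k := h / 4 * (1 - gam) / (2 * d.+1%:R).
have k0 : 0 < k.
  by rewrite divr_gt0 ?mulr_gt0 ?invr_gt0 ?subr_gt0.
have [vs [vsM vsnet]] := compact_net (@compact_norm_le R d (2 * h)) k0.
exists vs, k; split => // xi y x xi1 xc.
pose v := y + (h / 2) *: xi - x.
have [|u uvs vu] := vsnet v.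
  rewrite /= (le_trans (norm_le_enorm _))//.
  have -> : v = (h / 2) *: xi - (x - y) by apply/rowP => i; rewrite !mxE; ring.
  rewrite (le_trans (enormD _ _))// enormN enormZ xi1 ger0_norm; last first.
    by rewrite divr_ge0 ?(ltW h_gt0).
  by case/in_cone : xc => + _; move: h_gt0; lra.
exists u => // t e /andP[t0 t1] ek.
(* The target is a convex combination of [x], which lies in the cone, and of a point of the inner
   ball; [w] collects both errors. *)
pose w := t^-1 *: e - (v - u).
have -> : x + t *: u + e = (1 - t) *: x + t *: (y + (h / 2) *: xi + w).
  rewrite /w /v; apply/rowP => i; rewrite !mxE.
  by field; rewrite gt_eqF.
apply: cone_convex_comb => //; first by rewrite ltW.
apply: cone_inner_ball => //; apply: (le_lt_trans (enorm_le_norm w)).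
have wk : `|w| < 2 * k.
  rewrite (le_lt_trans (ler_normB _ _))// normrZ gtr0_norm ?invr_gt0//.
  have : t^-1 * `|e| < k by rewrite mulrC ltr_pdivrMr// mulrC.
  by lra.
apply: (@le_lt_trans _ _ (d.+1%:R * `|w|)); first by rewrite ler_wpM2r// ler_nat.
have -> : h / 4 * (1 - gam) = d.+1%:R * (2 * k).
  have : (d.+1%:R : R) != 0 by rewrite pnatr_eq0.
  by rewrite /k; move: (d.+1%:R : R) => D D0; field.
by rewrite ltr_pM2l.
Qed.

End cones.

(** * The boundary is a null set *)

Section lebesgue_rV_sets.
Context {R : realType} {d : nat}.
Local Notation mu := (@lebesgue_rV R d).
Implicit Types (x v : 'rV[R]_d) (r : R).

Lemma norm_lt_coord x v r : 0 < r ->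
  (`|v - x| < r) <-> forall i, ball (x ord0 i) r (v ord0 i).
Proof.
move=> r0; split=> [vx i|h].
  rewrite /ball /= distrC; apply: le_lt_trans vx.
  by have := coord_le_norm (v - x) i; rewrite !mxE.
rewrite /Num.norm /= mx_normrE; apply: bigmax_lt => // -[i j] _ /=.
by rewrite ord1 !mxE distrC; exact: h.
Qed.

Lemma lebesgue_rV_ball x r : 0 < r ->
  mu [set v : 'rV[R]_d | `|v - x| < r] = ((2 * r) ^+ d)%:E.
Proof.
move=> r0.
rewrite (_ : mkset _ = [set v : 'rV[R]_d | forall i, ball (x ord0 i) r (v ord0 i)]).
  rewrite (@lebesgue_rV_box R d (fun i => ball (x ord0 i) r)); last first.
    by move=> i; exact: measurable_ball.
  under eq_bigr do rewrite (lebesgue_measure_ball _ (ltW r0)) -mulr_natl.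
  by rewrite prodEFin prodr_const card_ord.
by apply/seteqP; split => v /= /(norm_lt_coord _ _ r0).
Qed.

Lemma measurable_norm_lt x r : measurable [set v : borelRV R d | `|v - x| < r].
Proof.
apply: open_borel_measurable.
rewrite (_ : mkset _ = (fun v => `|v - x|) @^-1` [set s | s < r])//.
apply: open_comp => [v _|]; last exact: open_lt.
apply: (@lipschitz_continuous_rV _ _ _ 1) => y z; rewrite mul1r [leRHS]addrC.
by rewrite (le_trans _ (ler_normD _ _))// [X in _ <= `|X|]addrA subrK.
Qed.

Lemma lebesgue_rV_bounded_lty (A : set (borelRV R d)) (M : R) :
  measurable A -> (forall x, A x -> `|x : 'rV[R]_d| <= M) -> (mu A < +oo)%E.
Proof.
move=> mA AM; have M0 : 0 < `|M| + 1 by rewrite ltr_pwDr.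
apply: (@le_lt_trans _ _ (mu [set v : 'rV[R]_d | `|v - 0| < `|M| + 1])).
  apply: le_measure; rewrite ?inE//; first exact: measurable_norm_lt.
  move=> x /AM xM /=; rewrite subr0 (le_lt_trans xM)//.
  by rewrite (le_lt_trans (ler_norm _))// ltrDl.
by rewrite lebesgue_rV_ball// ltry.
Qed.

Lemma measurable_affine_rV (c : R) v :
  measurable_fun setT (fun x : borelRV R d => (c *: x + v)%R : borelRV R d).
Proof.
apply: (@measurability _ _ (borelRV R d) (borelRV R d) setT _ (@open 'rV[R]_d)) => //.
move=> _ [U oU <-]; rewrite setTI; apply: open_borel_measurable.
rewrite openE => x /= Ux; apply/near_norm.
have /near_norm[e e0 eU] := open_nbhs_nbhs (conj oU Ux).
have K0 : 0 < `|c| + 1 by rewrite ltr_pwDr.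
exists (e / (`|c| + 1)); first by rewrite divr_gt0.
move=> y yx; apply: eU; rewrite opprD addrACA subrr addr0 -scalerBr normrZ.
apply: (@le_lt_trans _ _ ((`|c| + 1) * `|y - x|)); first by rewrite ler_wpM2r// lerDl.
by rewrite mulrC -ltr_pdivlMr.
Qed.

(* The translates of [A] along [v] by [1], [1/2], [1/3], etc. are pairwise
   disjoint, equimeasurable and contained in a bounded set. *)
Lemma lebesgue_rV_disjoint_translates (A : set (borelRV R d)) (M : R) v :
  measurable A -> (forall x, A x -> `|x : 'rV[R]_d| <= M) ->
  (forall x (t : R), A x -> 0 < t <= 1 -> ~ A (x + t *: v)) -> mu A = 0%E.
Proof.
move=> mA AM Av.
pose F (k : nat) : set (borelRV R d) :=
  (fun x : borelRV R d => x + - (k.+1%:R^-1 *: v) : 'rV[R]_d) @^-1` A.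
have mF k : measurable (F k).
  rewrite /F -[X in measurable X]setTI (_ : (fun x : borelRV R d => _) =
    (fun x : borelRV R d => (1 *: x + - (k.+1%:R^-1 *: v))%R : borelRV R d)).
    exact: measurable_affine_rV.
  by apply/funext => x; rewrite scale1r.
have tF : trivIset setT F.
  have hlt i j x : (i < j)%N -> F i x -> F j x -> False.
    move=> ij Fi Fj; apply: (Av (x + - (i.+1%:R^-1 *: v)) (i.+1%:R^-1 - j.+1%:R^-1)) => //.
      rewrite subr_gt0 ltf_pV2 ?posrE// ltr_nat ltnS ij/=.
      by rewrite lerBlDr (@le_trans _ _ 1)// ?invf_le1 ?ler1n// lerDl invr_ge0.
    by move: Fj; rewrite /F /=; congr (A _); rewrite scalerBl addrA subrK.
  apply/trivIsetP => i j _ _ ij; rewrite -subset0 => x [Fi Fj].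
  by case: (ltngtP i j) ij => // ij _; [exact: hlt ij Fi Fj|exact: hlt ij Fj Fi].
pose B : set (borelRV R d) := [set x | `|x - 0 : 'rV[R]_d| < `|M| + `|v| + 1].
have FB k : F k `<=` B.
  move=> x /AM /= xM; rewrite /B /= subr0 -(subrK (k.+1%:R^-1 *: v) x).
  rewrite (le_lt_trans (ler_normD _ _))// -addrA ler_ltD//.
    by rewrite (le_trans xM) ?ler_norm.
  rewrite normrZ ger0_norm// (@le_lt_trans _ _ `|v|) ?ltrDl//.
  by rewrite ler_piMl// invf_le1 ?ler1n.
have mB : measurable B by exact: measurable_norm_lt.
have Boo : mu B = ((2 * (`|M| + `|v| + 1)) ^+ d)%:E.
  by rewrite lebesgue_rV_ball// ltr_pwDr// addr_ge0.
have Aoo := lebesgue_rV_bounded_lty mA AM.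
have Afin : mu A \is a fin_num by rewrite ge0_fin_numE.
have le n : n%:R * fine (mu A) <= (2 * (`|M| + `|v| + 1)) ^+ d.
  rewrite -lee_fin -Boo EFinM fineK//.
  apply: (@le_trans _ _ (mu (\big[setU/set0]_(i < n) F i))); last first.
    apply: le_measure; rewrite ?inE//; first exact: bigsetU_measurable.
    by move=> x; rewrite -bigcup_mkord => -[k _] /FB.
  rewrite (measure_bigsetU _ mF tF).
  under eq_bigr do rewrite /= (lebesgue_rV_translate _ mA).
  by rewrite -(fineK Afin) sumEFin sumr_const card_ord -EFinM mulr_natl.
rewrite -(fineK Afin); congr EFin; apply/eqP; rewrite eq_le fine_ge0// andbT.
rewrite leNgt; apply/negP => a0.
pose n := Num.bound ((2 * (`|M| + `|v| + 1)) ^+ d / fine (mu A)).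
have := le n; rewrite leNgt => /negP; apply; rewrite -ltr_pdivrMr//.
by apply: archi_boundP; rewrite divr_ge0 ?exprn_ge0 ?mulr_ge0 ?addr_ge0// ltW.
Qed.

End lebesgue_rV_sets.

Lemma le_measure_seq_cover {disp} {T : measurableType disp} {R : realType}
    (mu : {measure set T -> \bar R}) (I : choiceType) (s : seq I) (A : set T)
    (F : I -> set T) : measurable A -> (forall i, measurable (F i)) ->
  (forall x, A x -> exists2 i, i \in s & F i x) ->
  (mu A <= \sum_(i <- s) mu (F i))%E.
Proof.
move=> mA mF AF; apply: (@le_trans _ _ (mu (\big[setU/set0]_(i <- s) F i))).
  apply: le_measure; rewrite ?inE//; first exact: bigsetU_measurable.
  by move=> x /AF[i iS Fi]; rewrite -bigcup_seq; exists i.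
elim: s {AF} => [|i s ih]; first by rewrite !big_nil measure0.
rewrite !big_cons; apply: le_trans (leeD2l _ ih).
apply: measureU2 => //; exact: bigsetU_measurable.
Qed.

Section boundary_null.
Context {R : realType} {d : nat}.
Variables (rho h : R) (rho_bounds : 0 < rho <= pi) (h_gt0 : 0 < h).

(* The points outside [S] from which one of finitely many fixed thin cones avoids [S]
   form a closed set, so every boundary point sees such a cone, and the part of the
   boundary seeing a given cone is disjoint from its translates along the axis. *)
Lemma lebesgue_rV_boundary (S : set 'rV[R]_d) : cone_convex rho h S ->
  @lebesgue_rV R d (boundary S) = 0%E.
Proof.
move=> [_ cptS SE]; have cS := compact_closed (@norm_hausdorff R 'rV[R]_d) cptS.
have [M M0 SM] := compact_norm_bounded cptS.
have [vs [k [k0 _ hvs]]] := @cone_directions R d rho h rho_bounds h_gt0.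
pose U v := [set x : 'rV[R]_d | forall (t : R) (e : 'rV[R]_d),
  0 < t <= 1 -> `|e| < t * k -> ~ S (x + t *: v + e)].
have cU v : closed (U v).
  rewrite -[U v]setCK closedC openE => x /= Ux; apply/near_norm.
  have [t [e [t01 ek Sx]]] : exists t e, [/\ 0 < t <= 1, `|e| < t * k
      & S (x + t *: v + e)].
    apply: contrapT => nx; apply: Ux => t e t01 ek Sx; apply: nx.
    by exists t, e.
  exists (t * k - `|e|); first by rewrite subr_gt0.
  (* The displacement [x - y] is absorbed into [e]: the strict bound on [e] leaves room for it. *)
  move=> y yx Uy; apply: (Uy t (e + (x - y)) t01).
    by rewrite (le_lt_trans (ler_normD _ _))// (distrC x) -ltrBrDl.
  by move: Sx; congr (S _); apply/rowP => i; rewrite !mxE; ring.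
have SU : ~` S `<=` \bigcup_(v in [set` vs]) U v.
  move=> x; rewrite /setC /= {1}SE => nx.
  have [[y xi] /= [xi1 yS] xc] : exists2 p : 'rV[R]_d * 'rV[R]_d,
      enorm p.2 = 1 /\ cone rho p.2 h p.1 `&` S = set0 & cone rho p.2 h p.1 x.
    apply: contrapT => hx; apply: nx => p /= hp xp; apply: hx.
    by exists p.
  have [v vvs hv] := hvs _ _ _ xi1 xc.
  exists v => // t e t01 ek Se.
  by have : set0 (x + t *: v + e) by rewrite -yS; split => //; exact: hv.
have bU x : boundary S x -> exists2 v, v \in vs & (S `&` U v) x.
  move=> bx; have Sx := boundary_sub cS bx.
  (* A boundary point is a limit of points outside [S], and a finite union of the closed sets [U v]
     contains its limits. *)
  have : closure (~` S) x by rewrite closure_setC; case: bx.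
  move=> /(closureS SU); have /closure_id <- : closed (\bigcup_(v in [set` vs]) U v).
    by apply: closed_bigcup => //; exact: finite_seq.
  by move=> [v vvs Uv]; exists v.
apply/eqP; rewrite eq_le measure_ge0 andbT.
have mSU v : measurable (S `&` U v : set (borelRV R d)).
  by apply: closed_borel_measurable; exact: closedI.
have SU0 v : @lebesgue_rV R d (S `&` U v) = 0%E.
  apply: (@lebesgue_rV_disjoint_translates R d _ M v (mSU v)).
    by move=> x [/SM].
  move=> x t [_ Ux] t01 [Sx _]; have /andP[t0 _] := t01.
  (* With [e = 0]: the axis of the thin cone itself avoids [S]. *)
  by apply: (Ux t 0 t01); rewrite ?normr0 ?mulr_gt0// addr0.
have mB := @closed_borel_measurable R d _ (@boundary_closed R d S).
have := @le_measure_seq_cover _ _ _ (@lebesgue_rV R d) _ vs _ _ mB mSU bU.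
by rewrite big1// => v _; exact: SU0.
Qed.

End boundary_null.

(** * Kneser's inequality for the inner volume *)

Section kneser.
Context {R : realType} {d : nat}.
Local Notation mu := (@lebesgue_rV R d).
Implicit Types (x y : 'rV[R]_d).

Lemma measurable_ge0_continuous (g : 'rV[R]_d -> R) : continuous g ->
  measurable ([set x | 0 <= g x] : set (borelRV R d)).
Proof.
move=> cg; apply: closed_borel_measurable.
rewrite (_ : mkset _ = g @^-1` [set r | 0 <= r])//.
by apply: preimage_closed => [x _|]; [exact: cg|exact: closed_ge].
Qed.

Lemma measurable_gt0_continuous (g : 'rV[R]_d -> R) : continuous g ->
  measurable ([set x | 0 < g x] : set (borelRV R d)).
Proof.
move=> cg; apply: open_borel_measurable.
rewrite (_ : mkset _ = g @^-1` [set r | 0 < r])//.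
by apply: open_comp => [x _|]; [exact: cg|exact: open_gt].
Qed.

(** [A] is the boundary of [S] or a finite net of it: Kneser's inequality is first proved for the
    net, which has finitely many Voronoi cells. *)
Definition shell (S A : set 'rV[R]_d) (al be : R) : set (borelRV R d) :=
  [set x | S x /\ al < edist_set (x : 'rV[R]_d) A <= be].

Lemma measurable_shell (S A : set 'rV[R]_d) al be :
  closed S -> A !=set0 -> measurable (shell S A al be).
Proof.
move=> cS A0; have lipA (x y : 'rV[R]_d) :
    edist_set x A <= edist_set y A + d%:R * `|x - y|.
  by rewrite (le_trans (edist_set_lip x y A0))// lerD2l enorm_le_norm.
rewrite (_ : shell S A al be = S `&` ([set x | 0 < edist_set x A - al] `&`
  [set x | 0 <= be - edist_set x A])); last first.
  by apply/seteqP; split => x /=; rewrite subr_gt0 subr_ge0 => -[? /andP].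
apply: (@measurableI _ (borelRV R d)); first exact: closed_borel_measurable.
apply: (@measurableI _ (borelRV R d)).
  apply: measurable_gt0_continuous; apply: (lipschitz_continuous_rV (K := d%:R)) => x y.
  by have := lipA x y; lra.
apply: measurable_ge0_continuous; apply: (lipschitz_continuous_rV (K := d%:R)) => x y.
by have := lipA y x; rewrite distrC; lra.
Qed.

Lemma enorm_sub_continuous (a b : 'rV[R]_d) :
  continuous (fun x => enorm (x - a) - enorm (x - b)).
Proof.
apply: (@lipschitz_continuous_rV _ _ _ (2 * d%:R)) => x y.
have := enorm_triangle x y a; have := enorm_triangle y x b.
have := enorm_le_norm (x - y); rewrite (enorm_distC y x); lra.
Qed.

Section voronoi.
Variables (m : nat) (a : 'I_m.+1 -> 'rV[R]_d).

(* Ties are broken by the least index, so that the cells partition the space. *)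
Definition voronoi (i : 'I_m.+1) : set 'rV[R]_d :=
  [set x | (forall j, enorm (x - a i) <= enorm (x - a j)) /\
           (forall j : 'I_m.+1, (j < i)%N -> enorm (x - a i) < enorm (x - a j))].

Lemma measurable_voronoi i : measurable (voronoi i : set (borelRV R d)).
Proof.
rewrite (_ : voronoi i =
  (\bigcap_(j in [set: 'I_m.+1]) [set x | 0 <= enorm (x - a j) - enorm (x - a i)]) `&`
  (\bigcap_(j in [set j : 'I_m.+1 | (j < i)%N])
    [set x | 0 < enorm (x - a j) - enorm (x - a i)])).
  apply: (@measurableI _ (borelRV R d)); apply: fin_bigcap_measurable => // j _.
    by apply: measurable_ge0_continuous; exact: enorm_sub_continuous.
  by apply: measurable_gt0_continuous; exact: enorm_sub_continuous.
apply/seteqP; split => x [h1 h2]; split.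
- by move=> j _ /=; rewrite subr_ge0.
- by move=> j ji /=; rewrite subr_gt0; exact: h2.
- by move=> j; have := h1 j I; rewrite /= subr_ge0.
- by move=> j ji; have := h2 j ji; rewrite /= subr_gt0.
Qed.

Lemma voronoi_cover x : exists i, voronoi i x.
Proof.
pose P k := [exists i : 'I_m.+1, (i == k :> nat) &&
  [forall j, enorm (x - a i) <= enorm (x - a j)]].
have exP : exists k, P k.
  have [i _ hi] := @arg_minP _ R _ ord0 xpredT (fun i => enorm (x - a i)) isT.
  exists i; apply/existsP; exists i; rewrite eqxx/=.
  by apply/forallP => j; exact: hi.
have [k /existsP[i /andP[/eqP ik /forallP hi]] kmin] := find_ex_minn exP.
exists i; split => // j ji; rewrite ltNge; apply/negP => hj.
have : P j by apply/existsP; exists j; rewrite eqxx; apply/forallP => l; exact: le_trans hj _.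
by move=> /kmin; rewrite -ik leqNgt ji.
Qed.

Lemma trivIset_voronoi : trivIset setT voronoi.
Proof.
have lt_disj (i j : 'I_m.+1) x : (i < j)%N -> voronoi i x -> voronoi j x -> False.
  by move=> ij [+ _] [_ /(_ i ij)]; move=> /(_ j); rewrite leNgt => /negP.
apply/trivIsetP => i j _ _ ij; rewrite -subset0 => x [Vi Vj].
have : i != j :> nat by [].
by case: ltngtP => // ij' _; [exact: lt_disj ij' Vi Vj|exact: lt_disj ij' Vj Vi].
Qed.

Lemma edist_set_voronoi i x : voronoi i x -> edist_set x (range a) = enorm (x - a i).
Proof.
move=> [Vi _]; apply/eqP; rewrite eq_le edist_set_le//=; last by exists i.
apply: lb_le_inf; first by exists (enorm (x - a i)), (a i) => //; exists i.
by move=> _ [_ [j _ <-] <-]; exact: Vi.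
Qed.

Definition contract (c : R) (p x : 'rV[R]_d) := c *: x + (1 - c) *: p.

Lemma contract_center c p x : contract c p x - p = c *: (x - p).
Proof. by apply/rowP => j; rewrite !mxE; ring. Qed.

Lemma contract_displacement c p x : x - contract c p x = (1 - c) *: (x - p).
Proof. by apply/rowP => j; rewrite !mxE; ring. Qed.

(** Moving [x] towards its own center shortens that distance by the whole displacement, and by the
    triangle inequality no other distance decreases by more. *)
Lemma voronoi_contract c i x : 0 <= c <= 1 -> voronoi i x ->
  voronoi i (contract c (a i) x).
Proof.
move=> /andP[c0 c1] [V1 V2].
have e1 : enorm (contract c (a i) x - a i) = c * enorm (x - a i).
  by rewrite contract_center enormZ ger0_norm.
have e2 j : enorm (x - a j) <=
    (1 - c) * enorm (x - a i) + enorm (contract c (a i) x - a j).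
  rewrite (le_trans (enorm_triangle _ (contract c (a i) x) _))//.
  by rewrite contract_displacement enormZ ger0_norm// subr_ge0.
split => j.
  by have := V1 j; have := e2 j; rewrite e1; lra.
by move=> /V2; have := e2 j; rewrite e1; lra.
Qed.

End voronoi.

Section finite_kneser.
Variables (S : set 'rV[R]_d) (cS : closed S) (m : nat) (a : 'I_m.+1 -> 'rV[R]_d)
  (eps : R) (a_net : forall x, edist_set x (range a) <= edist_set x (boundary S) + eps).

(* Contraction by the factor [1 / lam] towards the nearest center maps the part
   of the outer shell in a Voronoi cell into the part of the inner one. *)
Lemma finite_kneser (lam al be : R) : 1 <= lam -> 0 < al -> eps < al ->
  (mu (shell S (range a) (lam * al) (lam * be)) <=
   (lam ^+ d)%:E * mu (shell S (range a) al be))%E.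
Proof.
move=> lam1 al0 eps_al.
have a0 : range a !=set0 by exists (a ord0), ord0.
pose Z := shell S (range a) (lam * al) (lam * be).
pose W := shell S (range a) al be.
have mZ : measurable Z by exact: measurable_shell.
have mW : measurable W by exact: measurable_shell.
rewrite -/Z -/W.
have lam0 : 0 < lam by exact: lt_le_trans lam1.
have c01 : 0 <= lam^-1 <= 1 by rewrite invr_ge0 (ltW lam0) invf_le1.
have mV i : measurable (W `&` voronoi a i).
  by apply: measurableI => //; exact: measurable_voronoi.
have mV' i : measurable (Z `&` voronoi a i).
  by apply: measurableI => //; exact: measurable_voronoi.
have cell i : (mu (Z `&` voronoi a i) <=
    (lam ^+ d)%:E * mu (W `&` voronoi a i))%E.
  have c0 : 0 < lam^-1 by rewrite invr_gt0.
  (* The change of variables with ratio [lam^-1] produces exactly the factor that cancels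
     [lam ^+ d]. *)
  rewrite (lebesgue_rV_affine ((1 - lam^-1) *: a i) c0 (mV i)) muleA -EFinM.
  rewrite -exprMn mulfV ?gt_eqF// expr1n mul1e; apply: le_measure; rewrite ?inE//.
    by rewrite -[X in measurable X]setTI; exact: measurable_affine_rV.
  move=> x [[Sx /andP[lx ux]] Vx].
  have Vx' := voronoi_contract c01 Vx.
  rewrite /preimage/= -/(contract lam^-1 (a i) x); split=> //.
  move: lx ux; rewrite (edist_set_voronoi Vx) => lx ux; split; last first.
    rewrite (edist_set_voronoi Vx') contract_center enormZ ger0_norm ?(ltW c0)//.
    by rewrite mulrC ltr_pdivlMr// ler_pdivrMr// ![_ * lam]mulrC lx.
  (* If the contraction left [S], the boundary would be within [(1 - lam^-1) * enorm (x - a i)] of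
     [x]. By the net property it is at least [enorm (x - a i) - eps] away, while
     [lam^-1 * enorm (x - a i) > al > eps]. *)
  apply: contrapT => nS; have := edist_boundary_le cS Sx nS.
  rewrite enorm_distC contract_displacement enormZ ger0_norm; last first.
    by rewrite subr_ge0; case/andP: c01.
  have := a_net x; rewrite (edist_set_voronoi Vx).
  have : al < lam^-1 * enorm (x - a i) by rewrite mulrC ltr_pdivlMr// mulrC.
  by move: eps_al; lra.
apply: (@le_trans _ _ (\sum_(i <- enum 'I_m.+1)
    mu (Z `&` voronoi a i))%E).
  apply: le_measure_seq_cover => // x sx; have [i Vi] := voronoi_cover a x.
  by exists i => //; rewrite mem_enum.
rewrite big_enum/=; apply: le_trans (lee_sum _ (fun i _ => cell i)) _.
rewrite -ge0_sume_distrr//; apply: lee_wpmul2l.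
  by rewrite lee_fin exprn_ge0 ?(ltW lam0).
rewrite -(@measure_bigsetU_ord _ _ _ mu _ xpredT _ mV)//; last first.
  by apply: trivIset_setIl; exact: trivIset_voronoi.
apply: le_measure; rewrite ?inE//; first exact: bigsetU_measurable.
by move=> x; rewrite -bigcup_mkord_ord => -[i _ []].
Qed.

End finite_kneser.

End kneser.

Section inner_volume.
Context {R : realType} {d : nat}.
Local Notation mu := (@lebesgue_rV R d).
Variables (S : set 'rV[R]_d) (cptS : compact S) (bS0 : boundary S !=set0).
Local Notation F := (inner_volume S).

Let cS : closed S := compact_closed (@norm_hausdorff R 'rV[R]_d) cptS.

Let collar (z : R) : set (borelRV R d) :=
  [set x | S x /\ edist_set (x : 'rV[R]_d) (boundary S) <= z].

Lemma measurable_collar z : measurable (collar z).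
Proof.
rewrite (_ : collar z = shell S (boundary S) (- 1) z); first exact: measurable_shell.
apply/seteqP; split => x /= [Sx]; last by case/andP.
by move=> xz; split => //; rewrite xz andbT (lt_le_trans _ (edist_set_ge0 _ _)).
Qed.

Lemma inner_volumeE z : mu (collar z) = (F z)%:E.
Proof.
rewrite /inner_volume fineK// ge0_fin_numE//.
have [M M0 SM] := compact_norm_bounded cptS.
apply: (@lebesgue_rV_bounded_lty R d _ M); first exact: measurable_collar.
by move=> x [/SM].
Qed.

Lemma inner_volume_ge0 z : 0 <= F z.
Proof. by rewrite /inner_volume fine_ge0. Qed.

Lemma inner_volume_nondecreasing a b : a <= b -> F a <= F b.
Proof.
move=> ab; rewrite -lee_fin -!inner_volumeE; apply: le_measure; rewrite ?inE.
- exact: measurable_collar.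
- exact: measurable_collar.
- by move=> x /= [Sx xa]; split => //; exact: le_trans ab.
Qed.

Lemma inner_volume_shell a b : a <= b ->
  mu (shell S (boundary S) a b) = (F b - F a)%:E.
Proof.
move=> ab.
have sub : collar a `<=` collar b by move=> x [Sx xa]; split => //; exact: le_trans ab.
rewrite EFinB -!inner_volumeE -[in X in (_ - X)%E](setIidr sub) -measureD.
- congr (mu _); apply/seteqP; split => x /=.
    move=> [Sx /andP[ax xb]]; split; first by split.
    by move=> -[_]; rewrite leNgt ax.
  move=> [[Sx xb] nxa]; split => //; rewrite xb andbT ltNge; apply/negP => xa.
  by apply: nxa.
- exact: measurable_collar.
- exact: measurable_collar.
- by rewrite /= inner_volumeE ltry.
Qed.

(** Closed thresholds make the collars decrease to [collar z], so continuity from above applies. At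
    [z = 0] it yields the limit of [F] at the boundary. *)
Lemma inner_volume_right_continuous z (e : R) : 0 < e ->
  exists2 del : R, 0 < del & F (z + del) <= F z + e.
Proof.
move=> e0; pose C n := collar (z + n.+1%:R^-1).
have mC n : measurable (C n) by exact: measurable_collar.
have capC : \bigcap_n C n = collar z.
  apply/seteqP; split => [x Cx|x /= [Sx xz] n _]; last first.
    by split => //; rewrite (le_trans xz)// lerDl invr_ge0.
  split; first by have [] := Cx 0%N I.
  rewrite leNgt; apply/negP => zx.
  have [n _ /(_ n (leqnn n)) nx] := near_infty_natSinv_lt (PosNum (etrans (subr_gt0 _ _) zx)).
  have [_] := Cx n I; rewrite leNgt => /negP; apply.
  by rewrite -ltrBrDl.
have : (mu \o C) x @[x --> \oo] --> mu (\bigcap_n C n).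
  apply: nonincreasing_cvg_mu => //.
  - by rewrite /= (inner_volumeE (z + 1%:R^-1)) ltry.
  - by rewrite capC; exact: measurable_collar.
  - move=> i j ij; apply/subsetPset => x /= [Sx xz]; split => //.
    by rewrite (le_trans xz)// lerD2l lef_pV2 ?posrE// ler_nat ltnS.
rewrite capC inner_volumeE.
have -> : mu \o C = EFin \o (fun n => F (z + n.+1%:R^-1)).
  by apply/funext => n /=; rewrite /C inner_volumeE.
move/fine_cvgP => [_] /cvgrPdist_lt /(_ e e0)[N _ /(_ N (leqnn N))] /= hN.
exists N.+1%:R^-1; first by rewrite invr_gt0.
by move: hN; rewrite ltr_norml => /andP[+ _]; lra.
Qed.

(* The finite case applied to finer and finer nets of the boundary. *)
Lemma inner_volume_kneser (lam al be : R) : 1 <= lam -> 0 < al -> al <= be ->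
  F (lam * be) - F (lam * al) <= lam ^+ d * (F be - F al).
Proof.
move=> lam1 al0 ab; have lam0 : 0 < lam by exact: lt_le_trans lam1.
(* Replacing the boundary by a net costs [eps] in the thresholds. Both shifts go to the right, so
   right continuity removes them. *)
have approx (eps : R) : 0 < eps ->
    F (lam * be) - F (lam * (al + eps)) <= lam ^+ d * (F (be + eps) - F al).
  move=> e0; have [be_small|abe] := leP be (al + eps).
    rewrite (@le_trans _ _ 0)//.
      by rewrite subr_le0 inner_volume_nondecreasing// ler_pM2l.
    rewrite mulr_ge0 ?exprn_ge0 ?(ltW lam0)// subr_ge0 inner_volume_nondecreasing//.
    by rewrite (le_trans ab)// lerDl ltW.
  have cptB : compact (boundary S).
    apply: (subclosed_compact _ cptS); first exact: boundary_closed.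
    exact: boundary_sub.
  have de0 : 0 < eps / d.+1%:R by rewrite divr_gt0.
  have [s [sB snet]] := compact_net cptB de0.
  have [x0 Bx0] := bS0; have [v0 v0s _] := snet _ Bx0.
  have s0 : (0 < size s)%N by case: (s) v0s.
  pose m := (size s).-1; have mE : m.+1 = size s by rewrite prednK.
  pose a (i : 'I_m.+1) := nth 0 s i.
  have aB i : boundary S (a i) by apply: sB; rewrite mem_nth// -mE.
  have a0 : range a !=set0 by exists (a ord0), ord0.
  have net x : edist_set x (range a) <= edist_set x (boundary S) + eps.
    rewrite leNgt; apply/negP; rewrite -ltrBrDr => /(edist_set_lt bS0)[y By].
    rewrite ltrBrDr ltNge => /negP; apply.
    have [v vs yv] := snet _ By.
    have vi : (index v s < m.+1)%N by rewrite mE index_mem.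
    have av : range a v by exists (Ordinal vi) => //; rewrite /a /= nth_index.
    rewrite (le_trans (edist_set_le x av))// (le_trans (enorm_triangle x y v))//.
    rewrite lerD2l (le_trans (enorm_le_norm _))//.
    apply: (@le_trans _ _ (d.+1%:R * (eps / d.+1%:R))).
      by apply: ler_pM => //; [rewrite ler_nat|exact: ltW].
    by rewrite mulrC mulfVK// pnatr_eq0.
  have sub x : edist_set x (boundary S) <= edist_set x (range a).
    rewrite leNgt; apply/negP => /(edist_set_lt a0)[_ [i _ <-]].
    by rewrite ltNge edist_set_le.
  have := finite_kneser cS net (be + eps) lam1 (addr_gt0 al0 e0) (_ : eps < al + eps).
  rewrite ltrDr => /(_ al0) hk.
  have lab : lam * (al + eps) <= lam * be by rewrite ler_pM2l// ltW.
  have ab' : al <= be + eps by rewrite (le_trans ab)// lerDl ltW.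
  rewrite -lee_fin EFinM -(inner_volume_shell lab) -(inner_volume_shell ab').
  have mR u v : measurable (shell S (range a) u v) by exact: measurable_shell.
  have mB u v : measurable (shell S (boundary S) u v) by exact: measurable_shell.
  apply: (@le_trans _ _ (mu (shell S (range a) (lam * (al + eps)) (lam * (be + eps))))).
    apply: le_measure; rewrite ?inE// => x [Sx /andP[h1 h2]]; split => //.
    rewrite (lt_le_trans h1)//= (le_trans (net x))// mulrDr lerD//.
    by rewrite ler_peMl// ltW.
  apply: (le_trans hk); apply: lee_wpmul2l.
    by rewrite lee_fin exprn_ge0 ?(ltW lam0).
  apply: le_measure; rewrite ?inE// => x [Sx /andP[h1 h2]]; split => //.
  rewrite (le_trans (sub x))// andbT.
  by have := net x; lra.
have K0 : 0 < lam ^+ d + 1 by rewrite ltr_wpDl ?exprn_ge0 ?(ltW lam0).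
apply/ler_addgt0Pr => e e0; pose e' := e / (lam ^+ d + 1).
have e'0 : 0 < e' by rewrite divr_gt0.
have [d1 d10 h1] := inner_volume_right_continuous (lam * al) e'0.
have [d2 d20 h2] := inner_volume_right_continuous be e'0.
pose eps := Num.min (d1 / lam) d2.
have eps0 : 0 < eps by rewrite lt_min d20 divr_gt0.
have := approx _ eps0.
have : F (lam * (al + eps)) <= F (lam * al + d1).
  apply: inner_volume_nondecreasing; rewrite mulrDr lerD2l mulrC -ler_pdivlMr//.
  by rewrite ge_min lexx.
have : F (be + eps) <= F (be + d2).
  by apply: inner_volume_nondecreasing; rewrite lerD2l ge_min lexx orbT.
have eE : e = lam ^+ d * e' + e' by rewrite /e' ; field; rewrite gt_eqF.
move: h1 h2 (exprn_ge0 d (ltW lam0)); rewrite {}eE.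
move: (F _) (F _) (F _) (F _) (F _) (F _) (F _) (F _) => *; nra.
Qed.

End inner_volume.

(** * Real functions satisfying Kneser's inequality *)

Section kneser_function.
Context {R : realType}.
Variables (F : R -> R) (d : nat).
Hypothesis F_ge0 : forall z, 0 <= F z.
Hypothesis F_nd : forall a b, a <= b -> F a <= F b.
Hypothesis F_kneser : forall lam al be, 1 <= lam -> 0 < al -> al <= be ->
  F (lam * be) - F (lam * al) <= lam ^+ d * (F be - F al).

(* The [N] intervals [b / l^(k+1), b / l^k] with [l = b / a] are adjacent, and each of
   them carries at least [l^(- d N)] times the increment on [a, b]. *)
Lemma kneser_increment (a b : R) (N : nat) : 0 < a -> a <= b ->
  N%:R * (F b - F a) <= (b / a) ^+ (N * d) * F b.
Proof.
move=> a0 ab; have b0 : 0 < b by exact: lt_le_trans ab.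
set l := b / a; have l0 : 0 < l by rewrite divr_gt0.
have l1 : 1 <= l by rewrite ler_pdivlMr// mul1r.
have aE : a = b / l by rewrite /l invf_div mulrC mulfVK// gt_eqF.
clearbody l.
have step k : (k <= N)%N ->
    F b - F a <= l ^+ (N * d) * (F (b / l ^+ k) - F (b / l ^+ k.+1)).
  move=> kN; have lk0 : 0 < l ^+ k by rewrite exprn_gt0.
  have := @F_kneser (l ^+ k) (a / l ^+ k) (b / l ^+ k).
  rewrite ![l ^+ k * _]mulrC !mulfVK ?gt_eqF//.
  move=> /(_ (exprn_ege1 _ l1) (divr_gt0 a0 lk0)).
  rewrite ler_pM2r ?invr_gt0// => /(_ ab) /le_trans; apply.
  have -> : a / l ^+ k = b / l ^+ k.+1.
    by rewrite {1}aE exprS invfM mulrA.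
  apply: ler_wpM2r; last by rewrite -exprM ler_weXn2l// leq_mul2r kN orbT.
  rewrite subr_ge0 F_nd// ler_pM2l// lef_pV2 ?posrE ?exprn_gt0//.
  by rewrite ler_weXn2l.
have tele n : (n <= N)%N ->
    n%:R * (F b - F a) <= l ^+ (N * d) * (F b - F (b / l ^+ n)).
  elim: n => [|n ih nN]; first by rewrite expr0 divr1 subrr mul0r mulr0.
  rewrite -natr1 mulrDl mul1r.
  by have := ih (ltnW nN); have := step n (ltnW nN); lra.
apply: (le_trans (tele N (leqnn N))); rewrite ler_wpM2l ?exprn_ge0 ?(ltW l0)//.
by rewrite gerBl.
Qed.

(** [kneser_increment] bounds the increment by [(b / a) ^+ (N * d) * F B / N]. First [N] is chosen
    so that [2 * F B / N < e], then [eta] so that the power stays below 2. *)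
Lemma kneser_modulus (B e : R) : 0 < e -> exists2 eta : R, 0 < eta &
  forall a b, 0 < a -> a <= b -> b <= B -> b <= (1 + eta) * a -> F b - F a < e.
Proof.
move=> e0; pose N := (Num.bound (2 * F B / e)).+1.
have Ne : 2 * F B < N%:R * e.
  rewrite -ltr_pdivrMr// (@lt_le_trans _ _ (Num.bound (2 * F B / e))%:R)//.
    by apply: archi_boundP; rewrite divr_ge0 ?mulr_ge0// ltW.
  by rewrite ler_nat.
have N0 : 0 < N%:R :> R by rewrite ltr0n.
have : (fun x : R => x ^+ (N * d)) @ (1 : R) --> (1 : R) ^+ (N * d).
  exact: exprn_continuous.
move=> /cvgrPdist_lt /(_ 1 ltr01) /nbhs_ballP[r /= r0 hr].
exists (r / 2); first by rewrite divr_gt0.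
move=> a b a0 ab bB bra.
have l1 : 1 <= b / a by rewrite ler_pdivlMr// mul1r.
have lr : b / a <= 1 + r / 2 by rewrite ler_pdivrMr.
have /hr : ball (1 : R) r (b / a).
  by rewrite /ball /= ltr_norml; apply/andP; split; lra.
rewrite expr1n ltr_norml => /andP[h _].
have := kneser_increment N a0 ab.
have := F_nd bB; have := F_ge0 b; have := exprn_ege1 (N * d) l1 => p1 Fb0 FbB hN.
rewrite -(ltr_pM2l N0); apply: (le_lt_trans hN); apply: le_lt_trans Ne.
by apply: ler_pM => //; [exact: le_trans p1|lra].
Qed.

Lemma kneser_continuous (c : R) : 0 < c -> {for c, continuous F}.
Proof.
move=> c0; apply/cvgrPdist_lt => e e0.
have [eta eta0 H] := kneser_modulus (2 * c) e0.
(* The first bound keeps [x] between [c / 2] and [2 * c]; the second keeps the ratio of [x] and [c]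
   below [1 + eta]. *)
apply/nbhs_ballP; exists (Num.min (c / 2) (c * eta / 2)) => /=.
  by rewrite lt_min !divr_gt0 ?mulr_gt0.
move=> x; rewrite /ball /= lt_min ltr_norml => /andP[/andP[x1 x2]].
rewrite ltr_norml => /andP[x3 x4].
have x0 : 0 < x by lra.
have [xc|cx] := leP x c.
  rewrite ger0_norm ?subr_ge0 ?F_nd//; apply: H => //; first by lra.
  by have := mulr_gt0 eta0 (_ : 0 < x - c / 2); rewrite subr_gt0; nra.
rewrite ler0_norm ?subr_le0 ?F_nd ?ltW// opprB; apply: H => //; first exact: ltW.
  by lra.
by have := mulr_gt0 eta0 c0; lra.
Qed.

(* A quadratic touching the graph from below at an interior minimum fixes both
   one-sided slopes there, the upper bounds coming from the Kneser inequality. *)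
Lemma kneser_touching (al be : R) : 0 < al -> al < be ->
  exists c p K : R, [/\ al < c < be &
    forall t, al <= t <= be -> p * (t - c) - K * (t - c) ^+ 2 <= F t - F c].
Proof.
move=> al0 ab; pose m := (al + be) / 2; pose r := (be - al) / 2.
have r0 : 0 < r by rewrite divr_gt0 ?subr_gt0.
(* [K] is so large that [G] exceeds [G m = F m] at both endpoints, which forces the minimum into the
   interior. *)
pose K := (F m + 1) / r ^+ 2.
have Kr : K * r ^+ 2 = F m + 1 by rewrite mulfVK// gt_eqF ?exprn_gt0.
pose G t := F t + K * (t - m) ^+ 2.
have cG : {within `[al, be], continuous G}.
  apply: continuous_in_subspaceT => x; rewrite inE /= in_itv /= => /andP[ax xb].
  have x0 : 0 < x by exact: lt_le_trans ax.
  apply: cvgD; first exact: kneser_continuous.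
  apply: cvgM; first exact: cvg_cst.
  apply: (@continuous_comp _ _ _ (fun t : R => t - m) (fun t : R => t ^+ 2)).
    by apply: cvgB; [exact: cvg_id|exact: cvg_cst].
  exact: exprn_continuous.
have [c + Gc] := @EVT_min R G al be (ltW ab) cG.
rewrite in_itv /= => /andP[ac cb].
have mab : m \in `[al, be] by rewrite in_itv /= /m; apply/andP; split; lra.
have Gm : G m = F m by rewrite /G subrr expr0n mulr0 addr0.
have end_gt t : (t - m) ^+ 2 = r ^+ 2 -> t != c.
  move=> tm; apply/eqP => tc; have := Gc _ mab; rewrite Gm /G -tc tm Kr.
  by have := F_ge0 t; lra.
(* The parabola [- K * (t - m) ^+ 2], recentered at [c], has slope [2 * K * (m - c)] there. *)
exists c, (2 * K * (m - c)), K; split.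
  rewrite !lt_neqAle ac cb !andbT; apply/andP; split.
    by apply: end_gt; rewrite /m /r; field.
  by rewrite eq_sym; apply: end_gt; rewrite /m /r; field.
move=> t tab; have := Gc t; rewrite in_itv /= tab => /(_ isT); rewrite /G.
by lra.
Qed.

(** On either side of [c], touching bounds the difference quotient from one side. The opposite bound
    comes from the mirror point [w = c ^+ 2 / t]: scaling by [t / c] carries [[w, c]] onto [[c, t]]
    if [t > c], and scaling by [c / t] carries [[t, c]] onto [[c, w]] if [t < c]. *)
Lemma kneser_derivable (al be : R) : 0 < al -> al < be ->
  exists2 c : R, al < c < be & derivable F c 1.
Proof.
move=> al0 ab; have [c [p [K [/andP[ac cb] touch]]]] := kneser_touching al0 ab.
exists c; first by rewrite ac.
have c0 : 0 < c by exact: lt_trans ac.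
(* The value of the touching parabola at the mirror point, times [(t / c) ^+ d] and divided by
   [c - t]; it tends to [p]. *)
pose u t := (t / c) ^+ d * (p * (c / t) + K * (c / t) ^+ 2 * (t - c)).
pose Q t := (t - c)^-1 * (F t - F c).
have ucp : u @ c --> p.
  have -> : p = u c.
    by rewrite /u subrr mulr0 addr0 divff ?gt_eqF// expr1n mul1r mulr1.
  have cid : (id : R -> R) @ c --> c by exact: cvg_id.
  have civ : (fun t : R => c / t) @ c --> c / c.
    by apply: cvgM; [exact: cvg_cst|apply: cvgV => //; rewrite gt_eqF].
  apply: cvgM.
    apply: (@continuous_comp _ _ _ (fun t : R => t / c) (fun t : R => t ^+ d)).
      by apply: cvgM => //; exact: cvg_cst.
    exact: exprn_continuous.
  apply: cvgD; first by apply: cvgM => //; exact: cvg_cst.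
  apply: cvgM; last by apply: cvgB => //; exact: cvg_cst.
  apply: cvgM; first exact: cvg_cst.
  apply: (@continuous_comp _ _ _ (fun t : R => c / t) (fun t : R => t ^+ 2)) => //.
  exact: exprn_continuous.
have between t : al < t -> t < be -> al < c ^+ 2 / t -> c ^+ 2 / t < be -> t != c ->
    (p - K * (t - c) <= Q t <= u t) || (u t <= Q t <= p - K * (t - c)).
  move=> at0 tb ac2 c2b tc; have t0 : 0 < t by exact: lt_trans at0.
  pose w := c ^+ 2 / t.
  have tcw : t / c * w = c by rewrite /w; field; rewrite !gt_eqF.
  have touch_t := touch t; have touch_w := touch w.
  rewrite (ltW at0) (ltW tb) in touch_t; rewrite /w (ltW ac2) (ltW c2b) -/w in touch_w.
  have {touch_t} ht := touch_t isT; have {touch_w} hw := touch_w isT.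
  have wc : w - c = - (c / t) * (t - c) by rewrite /w; field; rewrite gt_eqF.
  have w0 : 0 < w by rewrite divr_gt0 ?exprn_gt0.
  have [t_lt|t_gt|//] := ltgtP t c; last by move=> E; rewrite E eqxx in tc.
  - apply/orP; right.
    have tc0 : 0 < c - t by rewrite subr_gt0.
    have QE : Q t = (F c - F t) / (c - t).
      by rewrite /Q -(opprB c t) -(opprB (F c)) invrN mulrNN mulrC.
    have lam1 : 1 <= c / t by rewrite ler_pdivlMr// mul1r ltW.
    have := F_kneser lam1 t0 (ltW t_lt).
    rewrite mulfVK ?gt_eqF// (_ : c / t * c = w); last by rewrite /w; ring.
    move=> hk; rewrite QE ler_pdivrMr// ler_pdivlMr//; apply/andP; split; last first.
      by move: ht; lra.
    rewrite -(ler_pM2l (exprn_gt0 d (divr_gt0 c0 t0))); apply: le_trans hk.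
    have ct1 : c / t * (t / c) = 1 by field; rewrite !gt_eqF.
    have -> : (c / t) ^+ d * (u t * (c - t)) = (c / t * (t / c)) ^+ d *
        (p * (w - c) - K * (w - c) ^+ 2).
      rewrite (exprMn _ (c / t) (t / c)) /u wc.
      by move: ((c / t) ^+ d) ((t / c) ^+ d) => A B; ring.
    by rewrite ct1 expr1n mul1r.
  - apply/orP; left.
    have tc0 : 0 < t - c by rewrite subr_gt0.
    have QE : Q t = (F t - F c) / (t - c) by rewrite /Q mulrC.
    have lam1 : 1 <= t / c by rewrite ler_pdivlMr// mul1r ltW.
    have wc' : w <= c by rewrite -subr_le0 wc mulNr oppr_le0 mulr_ge0 ?divr_ge0 ?ltW.
    have := F_kneser lam1 w0 wc'; rewrite tcw mulfVK ?gt_eqF// => hk.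
    rewrite QE ler_pdivrMr// ler_pdivlMr//; apply/andP; split.
      by move: ht; lra.
    have tcd0 : 0 <= (t / c) ^+ d by rewrite exprn_ge0// divr_ge0 ?(ltW t0) ?(ltW c0).
    apply: (le_trans hk); rewrite /u -[leRHS]mulrA ler_wpM2l//.
    rewrite -lerN2 opprB; apply: le_trans hw.
    by rewrite wc le_eqVlt; apply/orP; left; apply/eqP; ring.
suff QL : (fun h : R => h^-1 *: ((F \o shift c) (h *: 1) - F c)) @ 0^' --> p.
  by apply/cvg_ex; exists p.
apply/cvgrPdist_lt => e e0.
have cw : (fun t : R => c ^+ 2 / t) @ c --> c ^+ 2 / c.
  apply: cvgM; first exact: cvg_cst.
  by apply: cvgV; [rewrite gt_eqF|exact: cvg_id].
have c2c : c ^+ 2 / c = c by rewrite expr2 mulfK// gt_eqF.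
rewrite c2c in cw.
have near_c : \forall t \near c, [/\ al < t < be, al < c ^+ 2 / t < be,
    `|p - u t| < e & `|K * (t - c)| < e].
  have lp : (fun t : R => K * (t - c)) @ c --> (0 : R).
    rewrite -[X in _ --> X](mulr0 K) -(subrr c).
    apply: cvgM; first exact: cvg_cst.
    by apply: cvgB; [exact: cvg_id|exact: cvg_cst].
  have h1 : \forall t \near c, al < t < be.
    by near=> t; apply/andP; split; near: t; [exact: lt_nbhsr|exact: lt_nbhsl].
  have h2 : \forall t \near c, al < c ^+ 2 / t < be by exact: (cw _ h1).
  have /cvgrPdist_lt /(_ e e0) h3 := ucp.
  have /cvgrPdist_lt /(_ e e0) h4 := lp.
  near=> t; split; [near: t; exact: h1|near: t; exact: h2|near: t; exact: h3|].
  by rewrite -normrN -sub0r; near: t; exact: h4.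
have /nbhs_ballP[r /= r0 hr] := near_c.
apply/nbhs_ballP; exists r => //= h; rewrite /ball /= sub0r normrN => hr' h0.
have := hr (h + c); rewrite /ball /= opprD addrCA subrr addr0 normrN => /(_ hr').
move=> [/andP[t1 t2] /andP[w1 w2] ue le].
have tc : h + c != c by rewrite -subr_eq0 addrK.
have := between _ t1 t2 w1 w2 tc.
rewrite /Q addrK [_ *: (_ - _)]/GRing.scale /= [h *: 1]mulr1.
move: ue le; rewrite addrK !ltr_norml => /andP[u1 u2] /andP[k1 k2].
by case/orP => /andP[b1 b2]; apply/andP; split; lra.
Unshelve. all: by end_near. Qed.

(** A point [c] of differentiability between [a / 2] and [a] has right-hand slope below [q + 1] for
    steps shorter than some [r]. Scaling by [x / c] carries this bound to each [x] in [[a, b]],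
    which is then cut into steps shorter than [r]. As [c > a / 2], [b / c] is at most
    [2 * b / a]. *)
Lemma kneser_slope (s q : R) :
  (forall z, 0 < z <= s -> derivable F z 1 -> derive1 F z <= q) -> 0 < q ->
  forall a b : R, 0 < a -> a < b -> b <= s ->
    F b - F a <= (2 * b / a) ^+ d * (q + 1) * (b - a).
Proof.
move=> dF q0 a b a0 ab bs.
have [||c /andP[ac ca] Fc] := @kneser_derivable (a / 2) a; [lra|lra|].
have c0 : 0 < c by lra.
have cs : 0 < c <= s by rewrite c0; lra.
have := dF c cs Fc; rewrite derive1E => pq.
have : (fun h : R => h^-1 *: ((F \o shift c) (h *: 1) - F c)) @ 0^' --> 'D_1 F c by exact: Fc.
move=> /cvgrPdist_lt /(_ 1 ltr01) /nbhs_ballP[r /= r0 hr].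
have slope_c t : 0 < t < r -> F (c + t) - F c <= (q + 1) * t.
  move=> /andP[t0 tr]; have := hr t; rewrite /ball /= sub0r normrN gtr0_norm//.
  move=> /(_ tr (negbT (gt_eqF t0))).
  rewrite [_ *: (_ - _)]/GRing.scale /= [t *: 1]mulr1 ltr_norml => /andP[h _].
  rewrite addrC -ler_pdivrMr// mulrC.
  by move: h pq; rewrite (addrC t c); lra.
pose M := (b / c) ^+ d * (q + 1).
have slope x t : a <= x -> x <= b -> 0 < t < r -> F (x + t) - F x <= M * t.
  move=> ax xb /andP[t0 tr]; have x0 : 0 < x by lra.
  have lam1 : 1 <= x / c by rewrite ler_pdivlMr// mul1r; lra.
  (* [t * c / x] is the step at [c] that scaling by [x / c] turns into the step [t] at [x]. *)
  have t'0 : 0 < t * c / x by rewrite divr_gt0 ?mulr_gt0.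
  have t't : t * c / x <= t by rewrite ler_pdivrMr// ler_pM2l//; lra.
  have := @F_kneser (x / c) c (c + t * c / x) lam1 c0.
  rewrite lerDl => /(_ (ltW t'0)).
  have -> : x / c * (c + t * c / x) = x + t by field; rewrite !gt_eqF.
  rewrite mulfVK ?gt_eqF// => /le_trans; apply.
  have := slope_c (t * c / x); rewrite t'0 (le_lt_trans t't tr) => /(_ isT) hs.
  rewrite /M -[leRHS]mulrA; apply: ler_pM => //.
  - by rewrite exprn_ge0 ?divr_ge0 ?ltW.
  - by rewrite subr_ge0 F_nd// lerDl ltW.
  - have xcbc : x / c <= b / c by rewrite ler_pM2r ?invr_gt0.
    have xc0 : 0 <= x / c by rewrite divr_ge0 ?(ltW x0) ?(ltW c0).
    by rewrite lerXn2r// nnegrE (le_trans xc0).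
  - by rewrite (le_trans hs)// ler_pM2l//; lra.
pose N := (Num.bound ((b - a) / r)).+1.
have N0 : 0 < N%:R :> R by rewrite ltr0n.
pose t := (b - a) / N%:R.
have t0 : 0 < t by rewrite divr_gt0// subr_gt0.
have tr : t < r.
  rewrite ltr_pdivrMr// mulrC -ltr_pdivrMr//.
  rewrite (@lt_le_trans _ _ (Num.bound ((b - a) / r))%:R)// ?ler_nat//.
  by apply: archi_boundP; rewrite divr_ge0 ?subr_ge0 ?ltW.
have sum n : (n <= N)%N -> F (a + n%:R * t) - F a <= M * (n%:R * t).
  elim: n => [|n ih nN]; first by rewrite mul0r addr0 subrr mulr0.
  have := ih (ltnW nN); have := slope (a + n%:R * t) t.
  rewrite t0 tr lerDl mulr_ge0 ?(ltW t0)// => /(_ isT).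
  have -> : a + n%:R * t <= b.
    rewrite -lerBrDl (@le_trans _ _ (N%:R * t))//.
      by rewrite ler_pM2r// ler_nat ltnW.
    by rewrite /t mulrC mulfVK// gt_eqF.
  by rewrite -natr1 mulrDl mul1r addrA => /(_ isT isT); lra.
have := sum N (leqnn N); have -> : N%:R * t = b - a by rewrite /t mulrC mulfVK// gt_eqF.
rewrite addrCA subrr addr0 => /le_trans; apply.
rewrite ler_pM2r ?subr_gt0// /M ler_pM2r; last by lra.
rewrite lerXn2r ?nnegrE ?divr_ge0 ?mulr_ge0//; try by lra.
have b0 : 0 < b by exact: lt_trans ab.
rewrite ler_pdivrMr// mulrAC ler_pdivlMr//.
by have := ler_wpM2l (ltW b0) (ltW ac); lra.
Qed.

(** Telescoping over the intervals [[y / 2, y]], on each of which the factor of [kneser_slope] is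
    [4 ^+ d]; the remainder [F (z / 2 ^+ n)] is made small by the first hypothesis. *)
Lemma kneser_linear_bound (s q : R) :
  (forall e, 0 < e -> exists2 del, 0 < del & F del <= e) ->
  (forall z, 0 < z <= s -> derivable F z 1 -> derive1 F z <= q) -> 0 < q ->
  forall z : R, 0 < z <= s -> F z <= 4 ^+ d * (q + 1) * z.
Proof.
move=> F0 dF q0 z /andP[z0 zs]; set L := 4 ^+ d * (q + 1).
have half (y : R) : 0 < y -> y <= s -> F y - F (y / 2) <= L * (y - y / 2).
  move=> y0 ys; have := @kneser_slope s q dF q0 (y / 2) y.
  have -> : 2 * y / (y / 2) = 4 by field; rewrite gt_eqF.
  by apply; lra.
have dyadic n : F z <= F (z / 2 ^+ n) + L * (z - z / 2 ^+ n).
  elim: n => [|n ih]; first by rewrite expr0 divr1 subrr mulr0 addr0.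
  have p0 : 0 < z / 2 ^+ n by rewrite divr_gt0// exprn_gt0.
  have ps : z / 2 ^+ n <= s.
    rewrite (le_trans _ zs)// ler_pdivrMr ?exprn_gt0// ler_peMr ?(ltW z0)//.
    by rewrite exprn_ege1// ler1n.
  have := half _ p0 ps; have -> : z / 2 ^+ n / 2 = z / 2 ^+ n.+1 by rewrite exprSr invfM mulrA.
  by lra.
apply/ler_addgt0Pr => e e0; have [del del0 Fdel] := F0 e e0.
pose n := Num.bound (z / del).
have zn : z / 2 ^+ n <= del.
  rewrite ler_pdivrMr ?exprn_gt0// mulrC -ler_pdivrMr// ltW//.
  rewrite (@lt_le_trans _ _ n%:R)//.
    by apply: archi_boundP; rewrite divr_ge0 ?ltW.
  by rewrite -natrX ler_nat ltnW// ltn_expl.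
apply: (le_trans (dyadic n)); rewrite addrC lerD ?(le_trans (F_nd zn))//.
rewrite ler_wpM2l//; first by rewrite mulr_ge0 ?exprn_ge0//; lra.
by rewrite gerBl divr_ge0 ?exprn_ge0// ltW.
Qed.

End kneser_function.

(** * Bounds for the inner volume and the distribution *)

Lemma inner_volume_linear_bound {R : realType} {d : nat} (rho h s q : R)
    (S : set 'rV[R]_d) : (0 < d)%N -> 0 < rho <= pi -> 0 < h ->
  cone_convex rho h S -> 0 < s -> 0 < q ->
  (forall z : R, 0 < z <= s -> derivable (inner_volume S) z 1 ->
    derive1 (inner_volume S) z <= q) ->
  exists2 C : R, 0 <= C & forall z, 0 < z -> inner_volume S z <= C * z.
Proof.
move=> d0 rho_b h0 ccS s0 q0 dF; have [S0 cptS _] := ccS.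
have bS0 := boundary_neq0 d0 S0 cptS.
have F0 : inner_volume S 0 = 0.
  apply/EFin_inj; rewrite -(inner_volumeE cptS bS0).
  transitivity (@lebesgue_rV R d (boundary S)); last first.
    exact: (lebesgue_rV_boundary rho_b h0 ccS).
  congr (lebesgue_rV _).
  have cS := compact_closed (@norm_hausdorff R 'rV[R]_d) cptS.
  apply/seteqP; split => x /=.
    by move=> [_ /edist_set_le0]; apply => //; exact: boundary_closed.
  move=> bx; split; first exact: boundary_sub cS _ bx.
  by rewrite (le_trans (edist_set_le x bx))// subrr enorm0.
have small e : 0 < e -> exists2 del, 0 < del & inner_volume S del <= e.
  move=> /(inner_volume_right_continuous cptS bS0 0)[del del0].
  by rewrite add0r F0 add0r; exists del.
have lin := @kneser_linear_bound R (inner_volume S) d (inner_volume_ge0 S)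
  (inner_volume_nondecreasing cptS bS0) (inner_volume_kneser cptS bS0) s q small dF q0.
set L := 4 ^+ d * (q + 1) in lin.
have L0 : 0 <= L by rewrite mulr_ge0 ?exprn_ge0//; lra.
have [M M0 SM] := compact_norm_bounded cptS.
have [b bb] := bS0.
(* The threshold bounds the distance from [b] to every point of [S], so [V] is the whole volume; for
   [z > s] it is at most [V / s * z]. *)
pose V := inner_volume S (d%:R * (M + `|b|)).
have FV z : inner_volume S z <= V.
  rewrite -lee_fin -!(inner_volumeE cptS bS0); apply: le_measure; rewrite ?inE.
  - exact: measurable_collar.
  - exact: measurable_collar.
  move=> x /= [Sx _]; split => //; rewrite (le_trans (edist_set_le x bb))//.
  rewrite (le_trans (enorm_le_norm _))// ler_wpM2l//.
  by rewrite (le_trans (ler_normB _ _))// lerD2r; exact: SM.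
have V0 : 0 <= V by exact: inner_volume_ge0.
exists (L + V / s); first by rewrite addr_ge0// divr_ge0// ltW.
move=> z z0; have [zs|sz] := leP z s.
  have z_s : 0 < z <= s by rewrite z0.
  by rewrite (le_trans (lin z z_s))// ler_wpM2r ?(ltW z0)// lerDl divr_ge0// ltW.
rewrite (le_trans (FV z))// mulrDl (@le_trans _ _ (V / s * z))//.
  by rewrite mulrAC ler_pdivlMr// ler_wpM2l// ltW.
by rewrite lerDr mulr_ge0// ltW.
Qed.

(** Second countability: each point outside the support lies in a null cube with rational center and
    radius [1 / (k + 1)], and these cubes are countably many. *)
Lemma msupport_setC {R : realType} {d : nat} (nu : {measure set (borelRV R d) -> \bar R}) :
  measurable (~` msupport nu : set (borelRV R d)) -> nu (~` msupport nu) = 0%E.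
Proof.
move=> mS.
pose cube (p : {ffun 'I_d -> rat} * nat) : set (borelRV R d) :=
  [set v | `|v - (\row_i ratr (p.1 i) : 'rV[R]_d)| < p.2.+1%:R^-1].
pose G (n : nat) : set (borelRV R d) :=
  if unpickle n is Some p then (if nu (cube p) == 0%E then cube p else set0) else set0.
apply: measure_negligible => //.
apply: (@negligibleS _ _ _ nu (\bigcup_n G n)); last first.
  apply: negligible_bigcup => n; rewrite /G.
  case: unpickle => [p|]; last exact: negligible_set0.
  case: ifPn => [/eqP p0|_]; last exact: negligible_set0.
  by exists (cube p); split => //; exact: measurable_norm_lt.
move=> x /existsNP[U /not_implyP[Ux nuU]].
have /near_norm[e e0 eU] := open_nbhs_nbhs Ux.
have e20 : 0 < e / 2 by rewrite divr_gt0.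
have [k _ /(_ k (leqnn k)) ke] := near_infty_natSinv_lt (PosNum e20).
have k0 : 0 < k.+1%:R^-1 :> R by rewrite invr_gt0.
have /choice[q hq] : forall i : 'I_d,
    exists q : rat, ball (ratr q : R) k.+1%:R^-1 (x ord0 i).
  move=> i; have [||y [xy [q _ qy]]] := @dense_rat R (ball (x ord0 i : R) k.+1%:R^-1).
  - by exists (x ord0 i); exact: ballxx.
  - exact: ball_open.
  by exists q; rewrite qy; exact: ball_sym.
pose p := ([ffun i => q i], k) : {ffun 'I_d -> rat} * nat.
have px : cube p x.
  by apply/norm_lt_coord => // i; rewrite mxE ffunE; exact: hq.
exists (pickle p) => //; rewrite /G pickleK ifT//.
apply/eqP; apply/eqP; rewrite eq_le measure_ge0 andbT.
apply: (@le_trans _ _ (nu U)); last by rewrite leNgt; exact/negP.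
apply: le_measure; rewrite ?inE.
- exact: measurable_norm_lt.
- by apply: open_borel_measurable; case: Ux.
move=> v pv; apply: eU; move: px pv; rewrite /cube /=.
set c := \row_i _ => px pv; rewrite -(subrK c v) -addrA.
rewrite (le_lt_trans (ler_normD _ _))// [ltRHS]splitr ltrD//.
  exact: lt_trans ke.
by rewrite distrC; exact: lt_trans ke.
Qed.

Section density_bounds.
Context {R : realType} {d : nat}.
Local Notation mu := (@lebesgue_rV R d).
Variables (PX : set (borelRV R d) -> \bar R) (S : set 'rV[R]_d)
  (f : borelRV R d -> R) (k1 k2 : R).
Hypotheses (f_meas : measurable_fun setT f) (f_ge0 : forall x, 0 <= f x)
  (PX_density : forall A : set (borelRV R d), measurable A ->
    PX A = (\int[mu]_(x in A) (f x)%:E)%E)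
  (k1_gt0 : 0 < k1)
  (f_bounds : {ae mu, forall x : borelRV R d, S x -> k1 <= f x <= k2}).

Lemma density_lower_bound (A : set (borelRV R d)) : measurable A -> A `<=` S ->
  (k1%:E * mu A <= PX A)%E.
Proof.
move=> mA AS; rewrite PX_density// -integral_cst//; apply: ae_ge0_le_integral => //.
- by move=> x _; rewrite lee_fin ltW.
- by move=> x _; rewrite lee_fin.
- by apply/measurable_EFinP; exact: measurable_funTS.
by apply: filterS f_bounds => x /= fx /AS /fx /andP[h _]; rewrite lee_fin.
Qed.

(** The absolute value provides a nonnegative constant to integrate without a discussion of the sign
    of [k2]. *)
Lemma density_upper_bound (A : set (borelRV R d)) : measurable A -> A `<=` S ->
  (PX A <= `|k2|%:E * mu A)%E.
Proof.
move=> mA AS; rewrite PX_density// -integral_cst//; apply: ae_ge0_le_integral => //.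
- by move=> x _; rewrite lee_fin.
- by apply/measurable_EFinP; exact: measurable_funTS.
- by move=> x _; rewrite lee_fin.
apply: filterS f_bounds => x /= fx /AS /fx /andP[_ h]; rewrite lee_fin.
by rewrite (le_trans h)// ler_norm.
Qed.

End density_bounds.

(** The integral is a supremum over simple functions below the integrand, so it is monotone without
    measurability, which is not established for the random distance. *)
Lemma ge0_le_integral_nonmeasurable {disp} {T : measurableType disp} {R : realType}
    (mu : {measure set T -> \bar R}) (f g : T -> \bar R) :
  (forall x, 0 <= f x)%E -> (forall x, f x <= g x)%E ->
  (\int[mu]_x f x <= \int[mu]_x g x)%E.
Proof.
move=> f0 fg; rewrite !ge0_integralE//; last by move=> x _; exact: le_trans (fg x).
apply: le_ereal_sup => _ [k kf <-]; exists k => // x.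
by apply: le_trans (kf x) _; rewrite !patch_setT.
Qed.

(* [(1 - p)^n <= exp(- n p) <= (1 + n p / 2)^-2] *)
Lemma geometric_tail {R : realType} (p : R) (n : nat) : 0 <= p <= 1 -> (0 < n)%N -> 0 < p ->
  (1 - p) ^+ n <= 4 / (n%:R * p) ^+ 2.
Proof.
move=> /andP[p0 p1] n0 pp.
have np0 : 0 < n%:R * p / 2 by rewrite divr_gt0 ?mulr_gt0 ?ltr0n.
apply: (@le_trans _ _ (expR (- p) ^+ n)).
  by rewrite lerXn2r ?nnegrE ?subr_ge0 ?expR_ge0// -[1 - p]/(1 + - p) expR_ge1Dx.
have -> : expR (- p) ^+ n = (expR (n%:R * p / 2) ^+ 2)^-1.
  by rewrite -!expRM_natl -expRN; congr expR; field.
have -> : 4 / (n%:R * p) ^+ 2 = ((n%:R * p / 2) ^+ 2)^-1.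
  by field; rewrite !gt_eqF// ltr0n.
rewrite lef_pV2 ?posrE ?exprn_gt0 ?expR_gt0// lerXn2r ?nnegrE ?expR_ge0 ?(ltW np0)//.
by rewrite (le_trans _ (expR_ge1Dx _))// lerDr.
Qed.

(** * Probability of missing a point *)

(** [j] is the least index with [D <= 2 ^+ j * a]. If [j = 0], the bound 1 is enough. Otherwise [D]
    exceeds [2 ^+ j.-1 * a], so [n%:R * D ^+ d] is at least [2 ^+ j.-1], and [geometric_tail] gives
    [16 / xi ^+ 2 / 4 ^+ j]. *)
Lemma dyadic_tail {R : realType} (d n J : nat) (a xi D : R) : (0 < d)%N -> (0 < n)%N ->
  0 < a -> n%:R * a ^+ d = 1 -> 0 < xi -> 0 <= D -> xi * D ^+ d <= 1 -> D <= 2 ^+ J * a ->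
  exists2 j, (j <= J)%N & D <= 2 ^+ j * a /\
    (1 - xi * D ^+ d) ^+ n <= (1 + 16 / xi ^+ 2) / 4 ^+ j.
Proof.
move=> d0 n0 a0 na xi0 D0 p1 DJ.
have exj : exists j, D <= 2 ^+ j * a by exists J.
have p0 : 0 <= xi * D ^+ d by rewrite mulr_ge0 ?exprn_ge0 ?(ltW xi0).
have A0 : 0 <= 16 / xi ^+ 2 by rewrite divr_ge0 ?exprn_ge0 ?(ltW xi0).
exists (ex_minn exj); case: ex_minnP => j Dj minj; first exact: minj.
split => //; case: j => [|j] in Dj minj *.
  rewrite expr0 divr1 (@le_trans _ _ 1)//; last by rewrite lerDl.
  by rewrite exprn_ile1 ?subr_ge0// gerBl.
have Dgt : 2 ^+ j * a < D.
  by rewrite ltNge; apply/negP => /minj; rewrite ltnn.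
have Dp : 0 < D by rewrite (le_lt_trans _ Dgt)// mulr_ge0 ?exprn_ge0// ltW.
have Da : 2 ^+ j <= n%:R * D ^+ d.
  rewrite (@le_trans _ _ ((2 ^+ j) ^+ d))//.
    by rewrite ler_eXnr ?exprn_ege1 ?ler1n.
  have -> : (2 ^+ j) ^+ d = n%:R * (2 ^+ j * a) ^+ d.
    by rewrite exprMn mulrCA na mulr1.
  by rewrite ler_wpM2l// lerXn2r ?nnegrE ?mulr_ge0 ?exprn_ge0 ?(ltW a0) ?(ltW Dgt) ?(ltW Dp).
have pp : 0 < xi * D ^+ d by rewrite mulr_gt0 ?exprn_gt0.
apply: (le_trans (geometric_tail (_ : 0 <= _ <= 1) n0 pp)); first by rewrite p0.
apply: (@le_trans _ _ (4 / (xi * 2 ^+ j) ^+ 2)).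
  rewrite ler_pM2l// lef_pV2 ?posrE ?exprn_gt0 ?mulr_gt0 ?exprn_gt0 ?ltr0n//.
  rewrite lerXn2r ?nnegrE ?mulr_ge0 ?exprn_ge0 ?(ltW xi0) ?(ltW Dp)//.
  by rewrite mulrCA ler_pM2l.
have -> : 4 / (xi * 2 ^+ j) ^+ 2 = 16 / xi ^+ 2 / 4 ^+ j.+1.
  have -> : 4 ^+ j.+1 = 4 * (2 ^+ j) ^+ 2 :> R
    by rewrite exprS [(2 ^+ j) ^+ 2]expr2 -exprMn -natrM.
  by field; rewrite !gt_eqF// exprn_gt0.
by rewrite ler_wpM2r ?invr_ge0 ?exprn_ge0// lerDr.
Qed.

Lemma sum_half_le2 {R : realType} (J : nat) : \sum_(j < J) (2^-1 : R) ^+ j <= 2.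
Proof.
suff -> : \sum_(j < J) (2^-1 : R) ^+ j = 2 - 2 * (2^-1) ^+ J.
  by rewrite gerBl mulr_ge0// exprn_ge0// invr_ge0.
elim: J => [|J ih]; first by rewrite big_ord0 expr0 mulr1 subrr.
by rewrite big_ord_recr /= ih exprS; field.
Qed.

Section sampling.
Context {R : realType} {d : nat} {disp : measure_display} {T : measurableType disp}.
Variables (d_gt0 : (0 < d)%N) (P : probability T R) (X : nat -> {RV P >-> borelRV R d})
  (PX : probability (borelRV R d) R).
Hypothesis X_indep : mutually_independent P X.
Hypothesis X_law : forall (i : nat) (A : set (borelRV R d)),
  measurable A -> distribution P (X i) A = PX A.

Lemma prob_all_in (n : nat) (B : set (borelRV R d)) : measurable B ->
  P [set w | forall j, (j < n)%N -> B (X j w)] =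
    (fine (PX B) ^+ n)%:E.
Proof.
move=> mB.
have -> : [set w | forall j, (j < n)%N -> B (X j w)] =
    \bigcap_(i in [set` iota 0 n]) (X i @^-1` B).
  apply/seteqP; split => w /= h i.
    by rewrite /= mem_iota => /andP[_ i_lt]; exact: h.
  by move=> i_lt; apply: (h i); rewrite /= mem_iota add0n i_lt.
rewrite (X_indep (A := fun=> B) (iota_uniq 0 n) (fun=> mB)).
rewrite (eq_bigr (fun=> PX B)); last by move=> i _; rewrite -(X_law i mB).
rewrite -{1}(fineK (fin_num_measure PX B mB)) big_const_seq count_predT size_iota.
by elim: n => [|n ih] //=; rewrite ih -EFinM -exprS.
Qed.

Variables (S : set 'rV[R]_d) (cptS : compact S) (bS0 : boundary S !=set0).
Variables (c k : R) (v : 'rV[R]_d) (n : nat).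

(** The slice at [t = c * edist_set x (boundary S)] of the thin cone at [x] around [v], in the form
    used by [cone_directions]. *)
Definition probe (x : 'rV[R]_d) : set (borelRV R d) :=
  [set y | `|y - (x + (c * edist_set x (boundary S)) *: v)| <
           c * edist_set x (boundary S) * k].

(** A boundary point has an empty probe and counts as missed, in accordance with the bound
    [(1 - 0) ^+ n]. *)
Definition missed : set (borelRV R d * T) :=
  [set p | S p.1 /\ forall j, (j < n)%N -> ~ probe p.1 (X j p.2)].

Lemma measurable_missed : measurable missed.
Proof.
have cS := compact_closed (@norm_hausdorff R 'rV[R]_d) cptS.
have mD : measurable_fun setT (fun p : borelRV R d * T =>
    edist_set (p.1 : 'rV[R]_d) (boundary S) : measurableTypeR R).
  apply: (measurableT_comp (continuous_borel_measurable (edist_set_continuous bS0))).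
  exact: measurable_fst.
pose g j (i : 'I_d) (p : borelRV R d * T) : R :=
  c * edist_set (p.1 : 'rV[R]_d) (boundary S) * k -
  `|(X j p.2 : 'rV[R]_d) ord0 i - ((p.1 : 'rV[R]_d) ord0 i +
     c * edist_set (p.1 : 'rV[R]_d) (boundary S) * v ord0 i)|.
have mg j i : measurable_fun setT (g j i : _ -> measurableTypeR R).
  apply: measurable_funB.
    by apply: measurable_funM => //; exact: measurable_funM.
  apply: measurableT_comp => //; apply: measurable_funB.
    apply: (measurableT_comp (measurable_coord i)).
    by apply: (measurableT_comp (measurable_funPT (X j))); exact: measurable_snd.
  apply: measurable_funD.
    by apply: (measurableT_comp (measurable_coord i)); exact: measurable_fst.
  by apply: measurable_funM => //; exact: measurable_funM.
have probeE j (p : borelRV R d * T) :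
    probe p.1 (X j p.2) <-> forall i : 'I_d, 0 < g j i p.
  (* For a nonpositive radius both sides are false; on the right this takes at least one
     coordinate. *)
  have [r0|r0] := ltP 0 (c * edist_set (p.1 : 'rV[R]_d) (boundary S) * k).
    rewrite /probe /= norm_lt_coord//.
    by split=> h i; have := h i; rewrite /g subr_gt0 /ball /= !mxE distrC.
  split=> [h|h].
    by have := le_lt_trans (normr_ge0 _) h; rewrite ltNge r0.
  have := h (Ordinal d_gt0); rewrite /g subr_gt0 => /(le_lt_trans (normr_ge0 _)).
  by rewrite ltNge r0.
have -> : missed = (S `*` setT) `&` \bigcap_(j in `I_n)
    ~` (\bigcap_(i in [set: 'I_d]) (g j i @^-1` `]0, +oo[)).
  apply/seteqP; split => p /=.
    move=> [Sp hp]; split; first by split.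
    move=> j jn h; apply: (hp j jn); apply/probeE => i.
    by have := h i I; rewrite /= in_itv /= andbT.
  move=> [[Sp _] hp]; split => // j jn /probeE h; apply: (hp j jn) => i _ /=.
  by rewrite in_itv /= andbT.
apply: measurableI.
  by apply: measurableX => //; exact: closed_borel_measurable.
apply: fin_bigcap_measurable => // j _; apply: measurableC.
apply: fin_bigcap_measurable => // i _.
by rewrite -[X in measurable X]setTI; apply: mg => //; exact: measurable_itv.
Qed.

Hypothesis c_ge0 : 0 <= c.
Hypothesis k_ge0 : 0 <= k.

Lemma measurable_probe x : measurable (probe x).
Proof. exact: measurable_norm_lt. Qed.

(** A sup-norm ball of radius [r] has volume [(2 * r) ^+ d], so a probe inside [S] has mass at least
    [xi * edist_set x (boundary S) ^+ d]; independence raises the complementary probability to the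
    power [n]. *)
Lemma prob_missed_section (x : 'rV[R]_d) (xi k1 : R) : S x -> 0 < k1 ->
  xi = k1 * (2 * c * k) ^+ d ->
  (forall A : set (borelRV R d), measurable A -> A `<=` S ->
    k1%:E * lebesgue_rV A <= PX A)%E -> probe x `<=` S ->
  xi * edist_set x (boundary S) ^+ d <= 1 /\
  (P (xsection missed x) <= ((1 - xi * edist_set x (boundary S) ^+ d) ^+ n)%:E)%E.
Proof.
move=> Sx k10 xiE PXlow probeS; set D := edist_set x (boundary S).
have D0 : 0 <= D by exact: edist_set_ge0.
have mB := measurable_probe x.
have PXB_ge : ((xi * D ^+ d)%:E <= PX (probe x))%E.
  have r0 : 0 <= c * D * k by rewrite !mulr_ge0.
  move: r0; rewrite le_eqVlt => /predU1P[r0|r0].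
    have -> : xi * D ^+ d = 0; last exact: measure_ge0.
    rewrite xiE -mulrA -exprMn (_ : 2 * c * k * D = 2 * (c * D * k)); last by ring.
    by rewrite -r0 mulr0 expr0n gtn_eqF// mulr0.
  apply: le_trans (PXlow _ mB probeS); rewrite lebesgue_rV_ball// -EFinM lee_fin.
  by rewrite xiE -mulrA -exprMn le_eqVlt (_ : 2 * c * k * D = 2 * (c * D * k)) ?eqxx//; ring.
have PXB_fin := fin_num_measure PX _ mB.
have xi1 : xi * D ^+ d <= 1.
  by rewrite -lee_fin (le_trans PXB_ge)// probability_le1.
split => //.
have -> : xsection missed x =
    [set w | forall j, (j < n)%N -> (~` probe x) (X j w)].
  apply/seteqP; split => w; rewrite /xsection /= inE; first by case.
  by move=> h; split.
rewrite prob_all_in; last exact: measurableC.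
rewrite probability_setC// -(fineK PXB_fin) -EFinB /= lee_fin.
have b1 : fine (PX (probe x)) <= 1 by rewrite -lee_fin fineK// probability_le1.
have bx : xi * D ^+ d <= fine (PX (probe x)) by rewrite -lee_fin fineK.
by rewrite lerXn2r ?nnegrE ?subr_ge0// lerD2l lerN2.
Qed.

End sampling.

(** * Mean mass of the missed points *)

Section mean_missed_mass.
Context {R : realType} {d : nat} {disp : measure_display} {T : measurableType disp}.
Variables (d_gt0 : (0 < d)%N) (P : probability T R) (X : nat -> {RV P >-> borelRV R d})
  (PX : probability (borelRV R d) R).
Hypothesis X_indep : mutually_independent P X.
Hypothesis X_law : forall (i : nat) (A : set (borelRV R d)),
  measurable A -> distribution P (X i) A = PX A.
Variables (S : set 'rV[R]_d) (cptS : compact S) (bS0 : boundary S !=set0).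
Variables (c k k1 k2 C a : R) (v : 'rV[R]_d) (n : nat).
Hypotheses (c_gt0 : 0 < c) (k_gt0 : 0 < k) (k1_gt0 : 0 < k1) (k2_ge0 : 0 <= k2)
  (C_ge0 : 0 <= C) (n_gt0 : (0 < n)%N) (a_gt0 : 0 < a) (na1 : n%:R * a ^+ d = 1).
Hypotheses
  (PX_ge : forall A : set (borelRV R d), measurable A -> A `<=` S ->
    (k1%:E * lebesgue_rV A <= PX A)%E)
  (PX_le : forall A : set (borelRV R d), measurable A -> A `<=` S ->
    (PX A <= k2%:E * lebesgue_rV A)%E)
  (volume_le : forall z, 0 < z -> inner_volume S z <= C * z)
  (probe_sub : forall x, S x -> probe S c k v x `<=` S).

(* Layer cake over the dyadic collars [D <= 2^j a], on which the probability of
   missing the probe is O(4^-j). *)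
Lemma mean_missed_mass :
  (\int[P]_w PX (ysection (missed X S c k v n) w) <=
   (2 * k2 * C * (1 + 16 / (k1 * (2 * c * k) ^+ d) ^+ 2) * a)%:E)%E.
Proof.
set xi := k1 * (2 * c * k) ^+ d; set A := 1 + 16 / xi ^+ 2.
have xi0 : 0 < xi by rewrite mulr_gt0 ?exprn_gt0 ?mulr_gt0.
have A0 : 0 <= A by rewrite addr_ge0// divr_ge0 ?exprn_ge0 ?(ltW xi0).
have mM := measurable_missed d_gt0 X cptS bS0 c k v n.
have cS := compact_closed (@norm_hausdorff R 'rV[R]_d) cptS.
have := @indic_fubini_tonelli _ _ _ _ R PX P _ mM.
rewrite indic_fubini_tonelli_FE// indic_fubini_tonelli_GE// => fub.
rewrite -[leLHS]/(\int[P]_w (PX \o ysection (missed X S c k v n)) w)%E -fub.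
have [B B0 DB] := edist_boundary_bounded cptS bS0.
pose J := Num.bound (B / a).
have BJ : B <= 2 ^+ J * a.
  rewrite -ler_pdivrMr// ltW// (@lt_le_trans _ _ J%:R)//.
    by apply: archi_boundP; rewrite divr_ge0 ?(ltW B0) ?(ltW a_gt0).
  by rewrite -natrX ler_nat ltnW// ltn_expl.
pose E j : set (borelRV R d) :=
  [set x | S x /\ edist_set (x : 'rV[R]_d) (boundary S) <= 2 ^+ j * a].
have mE j : measurable (E j) by exact: measurable_collar.
(* The sum of these functions dominates the probability of missing: at each [x] in [S], the term
   selected by [dyadic_tail] is enough. *)
pose g (j : 'I_J.+1) (x : borelRV R d) : \bar R := (A / 4 ^+ j * \1_(E j) x)%:E.
have cj0 j : 0 <= A / 4 ^+ j by rewrite divr_ge0// exprn_ge0.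
have g0 j x : (0 <= g j x)%E by rewrite lee_fin mulr_ge0.
have mg j : measurable_fun setT (g j).
  by apply/measurable_EFinP; apply: measurable_funM => //; exact: measurable_indic.
apply: (@le_trans _ _ (\int[PX]_x (\sum_(j < J.+1) g j x))%E).
  apply: ge0_le_integral_nonmeasurable => x; first exact: measure_ge0.
  rewrite /=; have [Sx|nSx] := pselect (S x); last first.
    rewrite (_ : xsection _ x = set0) ?measure0; first by apply: sume_ge0 => j _.
    by apply/seteqP; split => w //; rewrite /xsection /= inE => -[].
  have [p1 hP] := prob_missed_section d_gt0 X_indep X_law (v := v) n (ltW c_gt0)
    (ltW k_gt0) Sx k1_gt0 erefl PX_ge (probe_sub Sx).
  have [j jJ [Dj hj]] := dyadic_tail d_gt0 n_gt0 a_gt0 na1 xi0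
    (edist_set_ge0 x (boundary S)) p1 (le_trans (DB x Sx) BJ).
  have jJ1 : (j < J.+1)%N by [].
  apply: (le_trans hP); rewrite (bigD1 (Ordinal jJ1))//=.
  apply: (@le_trans _ _ (g (Ordinal jJ1) x)); last first.
    by rewrite leeDl//; apply: sume_ge0.
  rewrite /g lee_fin indicE mem_set ?mulr1//.
rewrite ge0_integral_sum//.
(* Collar [j] has mass at most [k2 * C * (2 ^+ j * a)]; against the weight [A / 4 ^+ j] this leaves
   the ratio 1/2. *)
apply: (@le_trans _ _ (\sum_(j < J.+1) (k2 * C * A * a * (2^-1) ^+ j)%:E)%E).
  apply: lee_sum => j _; rewrite /g.
  under eq_integral do rewrite EFinM.
  rewrite ge0_integralZl//; last 2 first.
  - by apply/measurable_EFinP; exact: measurable_indic.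
  - by rewrite lee_fin.
  rewrite integral_indic// setIT.
  have PE : (PX (E j) <= (k2 * (C * (2 ^+ j * a)))%:E)%E.
    apply: (le_trans (PX_le (mE j) _)); first by move=> x [].
    rewrite EFinM lee_wpmul2l ?lee_fin// (inner_volumeE cptS bS0) lee_fin.
    by apply: volume_le; rewrite mulr_gt0 ?exprn_gt0.
  apply: (le_trans (lee_wpmul2l _ PE)); first by rewrite lee_fin.
  rewrite -EFinM lee_fin.
  have -> : 4 ^+ j = 2 ^+ j * 2 ^+ j :> R by rewrite -exprMn -natrM.
  by rewrite exprVn le_eqVlt; apply/orP; left; apply/eqP; field; rewrite gt_eqF ?exprn_gt0.
rewrite sumEFin lee_fin -mulr_sumr.
apply: (@le_trans _ _ (k2 * C * A * a * 2)).
  by rewrite ler_wpM2l ?sum_half_le2// !mulr_ge0 ?(ltW a_gt0).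
by rewrite le_eqVlt; apply/orP; left; apply/eqP; ring.
Qed.

End mean_missed_mass.

(** * The convergence rate *)

Theorem theorem7 (R : realType) (d : nat) (d_gt0 : (0 < d)%N)
  (rho h : R) (rho_bounds : 0 < rho <= pi) (h_gt0 : 0 < h)
  (S : set 'rV[R]_d) (S_cone_convex : cone_convex rho h S)
  (F_deriv_bounded : exists s q : R, [/\ 0 < s, 0 < q &
     forall z : R, 0 < z <= s -> derivable (inner_volume S) z 1 ->
       derive1 (inner_volume S) z <= q])
  (disp : measure_display) (T : measurableType disp) (P : probability T R)
  (X : nat -> {RV P >-> borelRV R d})
  (PX : probability (borelRV R d) R)
  (X_indep : mutually_independent P X)
  (X_law : forall (i : nat) (A : set (borelRV R d)),
     measurable A -> distribution P (X i) A = PX A)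
  (PX_support : msupport PX = S)
  (f : borelRV R d -> R) (f_meas : measurable_fun setT f)
  (f_ge0 : forall x, 0 <= f x)
  (PX_density : forall A : set (borelRV R d), measurable A ->
     PX A = (\int[lebesgue_rV]_(x in A) (f x)%:E)%E)
  (k1 k2 : R) (k1_gt0 : 0 < k1)
  (f_bounds : {ae lebesgue_rV, forall x : borelRV R d, S x -> k1 <= f x <= k2}) :
  exists C : R, \forall n \near \oo,
    ('E_P [fun w => fine (symdiff_dist PX S (cone_hull rho h (sample X n w)))]
       <= (C * n%:R `^ (- d%:R^-1))%:E)%E.
Proof.
have [S0 cptS SE] := S_cone_convex.
have cS := compact_closed (@norm_hausdorff R 'rV[R]_d) cptS.
have bS0 := boundary_neq0 d_gt0 S0 cptS.
have [s [q [s0 q0 dF]]] := F_deriv_bounded.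
have [C C0 volume_le] :=
  inner_volume_linear_bound d_gt0 rho_bounds h_gt0 S_cone_convex s0 q0 dF.
have [B B0 DB] := edist_boundary_bounded cptS bS0.
have [vs [k [k0 vs_le hvs]]] := @cone_directions R d rho h rho_bounds h_gt0.
(* As [B] bounds the distance to the boundary on [S], the parameter [c * D] is at most 1, as [hvs]
   requires; and [c * (d%:R * (2 * h + k)) < 1] keeps the probe closer to [x] than the boundary. *)
pose c := (B + d%:R * (2 * h + k) + 1)^-1.
have den0 : 0 < B + d%:R * (2 * h + k) + 1.
  by rewrite ltr_wpDl// addr_ge0 ?(ltW B0)// mulr_ge0//; lra.
have c0 : 0 < c by rewrite invr_gt0.
have cden : c * (B + d%:R * (2 * h + k) + 1) = 1 by rewrite mulVf// gt_eqF.
have dhk0 : 0 <= d%:R * (2 * h + k) by rewrite mulr_ge0//; lra.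
have t_le1 x : S x -> c * edist_set x (boundary S) <= 1.
  by move=> Sx; rewrite -cden ler_pM2l// (le_trans (DB x Sx))//; lra.
have probe_sub v x : v \in vs -> S x -> probe S c k v x `<=` S.
  move=> vvs Sx y; rewrite /probe /=; set D := edist_set x (boundary S) => yB.
  apply: contrapT => nSy.
  have D0 : 0 <= D by exact: edist_set_ge0.
  have yx : `|y - x : 'rV[R]_d| <= c * D * k + c * D * (2 * h).
    have -> : (y : 'rV[R]_d) - x = (y - (x + (c * D) *: v) : 'rV[R]_d) + (c * D) *: v.
      by apply/rowP => i; rewrite !mxE; ring.
    rewrite (le_trans (ler_normD _ _))// lerD ?(ltW yB)//.
    rewrite normrZ ger0_norm ?mulr_ge0 ?(ltW c0)//.
    by rewrite ler_wpM2l ?vs_le// mulr_ge0// ltW.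
  have Dp : 0 < D.
    rewrite lt_def D0 andbT; apply/eqP => Dz.
    by have := le_lt_trans (normr_ge0 _) yB; rewrite Dz mulr0 mul0r ltxx.
  have := edist_boundary_le cS Sx nSy; rewrite -/D leNgt => /negP; apply.
  rewrite (le_lt_trans (enorm_le_norm _))//.
  have := ler_wpM2l (ler0n R d) yx.
  have : D * (c * (d%:R * (2 * h + k))) < D * 1.
    by rewrite ltr_pM2l// -[ltRHS]cden ltr_pM2l//; lra.
  by lra.
have PX_ge := density_lower_bound f_meas f_ge0 PX_density k1_gt0 f_bounds.
have PX_le := density_upper_bound f_meas f_ge0 PX_density f_bounds.
have PXnS : PX (~` S) = 0%E.
  rewrite -PX_support; apply: msupport_setC; rewrite PX_support.
  by apply: measurableC; exact: closed_borel_measurable.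
pose K := 2 * `|k2| * C * (1 + 16 / (k1 * (2 * c * k) ^+ d) ^+ 2).
exists ((size vs)%:R * K); exists 1%N => // n /= n0.
set a := n%:R `^ (- d%:R^-1).
have n0R : 0 < n%:R :> R by rewrite ltr0n.
have a0 : 0 < a by rewrite powR_gt0.
have na1 : n%:R * a ^+ d = 1.
  rewrite -powR_mulrn ?(ltW a0)// /a -powRrM mulNr mulVf ?pnatr_eq0 ?gtn_eqF//.
  by rewrite powR_inv1 ?(ltW n0R)// mulfV// gt_eqF.
pose A v := missed X S c k v n.
have mA v : measurable (A v) by exact: measurable_missed.
have hull_missed w : (symdiff_dist PX S (cone_hull rho h (sample X n w)) <=
    \sum_(v <- vs) PX (ysection (A v) w))%E.
  set H := cone_hull rho h _.
  have mH : measurable (H : set (borelRV R d)).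
    by apply: closed_borel_measurable; exact: cone_hull_closed.
  have mS : measurable (S : set (borelRV R d)) by exact: closed_borel_measurable.
  (* The hull of the sample may stick out of [S], but only by a set of mass 0, as [PX] is carried by
     its support. *)
  rewrite /symdiff_dist (_ : PX (H `\` S) = 0%E) ?adde0; last first.
    apply/eqP; rewrite eq_le measure_ge0 andbT -PXnS.
    by apply: le_measure; rewrite ?inE; [exact: measurableD|exact: measurableC|move=> x []].
  apply: le_measure_seq_cover; first exact: measurableD.
    by move=> v; exact: measurable_ysection.
  move=> x [Sx nHx].
  have [[y xi] /= [xi1 yS] xc] : exists2 p : 'rV[R]_d * 'rV[R]_d,
      enorm p.2 = 1 /\ cone rho p.2 h p.1 `&` sample X n w = set0 & cone rho p.2 h p.1 x.
    apply: contrapT => hx; apply: nHx => p /= hp xp; apply: hx.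
    by exists p.
  have [v vvs hv] := hvs _ _ _ xi1 xc.
  exists v => //; rewrite /ysection /= inE; split => // j jn /= pj.
  have D0 : 0 < c * edist_set x (boundary S).
    rewrite ltNge; apply/negP => D0; have := le_lt_trans (normr_ge0 _) pj.
    by rewrite ltNge => /negP; apply; rewrite mulr_le0_ge0// ltW.
  have t01 : 0 < c * edist_set x (boundary S) <= 1 by rewrite D0 t_le1.
  (* With [t = c * D] and [e] the offset of [X j w] from the center of the probe, the sample point
     would lie in the cone that avoids the sample. *)
  have := hv _ _ t01 pj; rewrite addrC subrK => Xc.
  have : set0 (X j w : 'rV[R]_d) by rewrite -yS; split => //; exists j.
  by [].
rewrite unlock.
apply: (@le_trans _ _ (\int[P]_w (\sum_(v <- vs) PX (ysection (A v) w)))%E).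
  apply: ge0_le_integral_nonmeasurable => w.
    by rewrite lee_fin fine_ge0// /symdiff_dist adde_ge0.
  apply: le_trans (hull_missed w); rewrite fineK//.
  by rewrite /symdiff_dist fin_numD; apply/andP; split; apply: fin_num_measure;
    apply: measurableD; apply: closed_borel_measurable => //; exact: cone_hull_closed.
rewrite ge0_integral_sum//; last first.
  by move=> v; exact: measurable_fun_ysection.
apply: (@le_trans _ _ (\sum_(v <- vs) (K * a)%:E)%E).
  rewrite !big_seq; apply: lee_sum => v vvs; apply: mean_missed_mass => //.
  by move=> x; exact: probe_sub.
by rewrite sumEFin lee_fin big_const_seq count_predT iter_addr_0 -[leRHS]mulrA mulr_natl.
Qed.
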